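(* Let $H$ be a finite-dimensional pointed Hopf algebra over $\mathbb{C}$. Then $\mathrm{qexp}(H)=\exp(G(H))$.
   Context: A Hopf algebra is pointed if all its irreducible corepresentations are $1$-dimensional. $G(H)$ is the group of grouplike elements of $H$, and the exponent $\exp(G)$ of a finite group $G$ is the least common multiple of the orders of its elements. For a finite-dimensional Hopf algebra $H$ over $\mathbb{C}$, the Drinfeld double $D(H)=H^{*cop}\otimes H$ is the quasitriangular Hopf algebra which contains $H$ and $H^{*cop}$ (the dual Hopf algebra with opposite comultiplication) as Hopf subalgebras, for which multiplication $H^{*cop}\otimes H\to D(H)$ is a linear isomorphism, and whose universal $R$-matrix is $R=\sum_i h_i\otimes h_i^*$, where $\{h_i\}$, $\{h_i^*\}$ are dual bases of $H$ and $H^*$ (so $R\Delta(x)=\Delta^{op}(x)R$ for $x\in D(H)$). Its Drinfeld element is $u=\sum_i S(h_i^* )h_i$, with $S$ the antipode of $D(H)$. The quasi-exponent $\mathrm{qexp}(H)$ is the smallest positive integer $n$ such that $u^n$ is unipotent, i.e. $(1-u^n)^N=0$ for some positive integer $N$; it is known to be finite. *)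

(* Defs.v *)
From HB Require Import structures.
From mathcomp Require Import all_boot all_algebra all_fingroup all_solvable.
From mathcomp Require Import all_field boolp classical_sets reals complex.

Set Implicit Arguments.
Unset Strict Implicit.
Unset Printing Implicit Defensive.

Import GRing.Theory.
Local Open Scope ring_scope.

Declare Scope hopf_scope.
Delimit Scope hopf_scope with hopf.
Local Open Scope hopf_scope.

Reserved Notation "v ⊗ w" (at level 39, left associativity).

(* The tensor product V ⊗ W, as the matrices of coefficients with respect to  *)
(* the products of the vectors of the library bases of V and W.               *)
(* The universal property is tliftE and tens_ext.                             *)
Section TensorProduct.
Variable F : fieldType.

Definition tens (V W : vectType F) : Type :=
  'M[F]_(\dim {:V}, \dim {:W}).

HB.instance Definition _ (V W : vectType F) :=
  Vector.copy (tens V W) 'M[F]_(\dim {:V}, \dim {:W}).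

Definition bvec (V : vectType F) (i : 'I_(\dim {:V})) : V := (vbasis {:V})`_i.

Definition bcoord (V : vectType F) (i : 'I_(\dim {:V})) (v : V) : F :=
  coord (vbasis {:V}) i v.

HB.instance Definition _ (V : vectType F) (i : 'I_(\dim {:V})) :=
  GRing.isLinear.Build F V F *%R (bcoord i)
    (@coord_is_scalar F V _ (vbasis {:V}) i).

Definition ptens (V W : vectType F) (v : V) (w : W) : tens V W :=
  \matrix_(i, j) (bcoord i v * bcoord j w).

Notation "v ⊗ w" := (ptens v w) : hopf_scope.

(* For bilinear f, the linear map V ⊗ W -> U that f induces.                  *)
Definition tlift (V W U : vectType F) (f : V -> W -> U) (t : tens V W) : U :=
  \sum_i \sum_j t i j *: f (bvec i) (bvec j).

Definition bilin (V W U : vectType F) (f : V -> W -> U) : Prop :=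
  bilinear_for *:%R *:%R f.

Definition tmap (V W V' W' : vectType F) (f : V -> V') (g : W -> W') :
  tens V W -> tens V' W' := tlift (fun v w => f v ⊗ g w).

Definition tswap (V W : vectType F) : tens V W -> tens W V :=
  tlift (fun v w => w ⊗ v).

Definition tassoc (V W U : vectType F) :
    tens (tens V W) U -> tens V (tens W U) :=
  tlift (fun t u => tlift (fun v w => v ⊗ (w ⊗ u)) t).

Definition tensv (V W : vectType F) (A : {vspace V}) (B : {vspace W}) :
  {vspace tens V W} :=
  <<[seq a ⊗ b | a <- vbasis A, b <- vbasis B]>>%VS.

Lemma bvec_coord (V : vectType F) (v : V) :
  v = \sum_i bcoord i v *: bvec i.
Proof. exact: coord_vbasis (memvf v). Qed.

Lemma bcoord_bvec (V : vectType F) (i j : 'I_(\dim {:V})) :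
  bcoord i (bvec j) = (i == j)%:R.
Proof.
by rewrite /bcoord /bvec coord_free ?(basis_free (vbasisP _)) // eq_sym.
Qed.

Lemma ptens_bilin (V W : vectType F) : bilin (@ptens V W).
Proof.
split=> [w a v v' | v a w w']; apply/matrixP=> i j; rewrite !mxE linearP /=.
  by rewrite mulrDl mulrA.
by rewrite mulrDr mulrCA.
Qed.

Lemma tlift_is_linear (V W U : vectType F) (f : V -> W -> U) :
  linear (tlift f).
Proof.
move=> a s t; rewrite /tlift scaler_sumr -big_split; apply: eq_bigr => i _ /=.
rewrite scaler_sumr -big_split; apply: eq_bigr => j _ /=.
by rewrite !mxE scalerDl scalerA.
Qed.

HB.instance Definition _ (V W U : vectType F) (f : V -> W -> U) :=
  GRing.isLinear.Build F (tens V W) U *:%R (tlift f) (tlift_is_linear f).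
HB.instance Definition _ (V W V' W' : vectType F) (f : V -> V') (g : W -> W') :=
  GRing.Linear.copy (tmap f g) (tlift (fun v w => f v ⊗ g w)).
HB.instance Definition _ (V W : vectType F) :=
  GRing.Linear.copy (@tswap V W) (tlift (fun v w => w ⊗ v)).
HB.instance Definition _ (V W U : vectType F) :=
  GRing.Linear.copy (@tassoc V W U)
    (tlift (fun t u => tlift (fun v w => v ⊗ (w ⊗ u)) t)).

Lemma bilinDl (V W U : vectType F) (f : V -> W -> U) : bilin f ->
  forall w, linear (f^~ w).
Proof. by case. Qed.

Lemma bilinDr (V W U : vectType F) (f : V -> W -> U) : bilin f ->
  forall v, linear (f v).
Proof. by case. Qed.

Lemma lin_sum (V U : vectType F) (f : V -> U) (I : Type) (r : seq I)
    (c : I -> F) (v : I -> V) : linear f ->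
  f (\sum_(i <- r) c i *: v i) = \sum_(i <- r) c i *: f (v i).
Proof.
move=> lf.
have f0 : f 0 = 0.
  by have := lf (-1) 0 0; rewrite scaler0 addr0 scaleN1r addNr.
by elim: r => [|i r IH]; rewrite ?big_nil // !big_cons lf IH.
Qed.

Lemma tens_pure (V W : vectType F) (t : tens V W) :
  t = \sum_i \sum_j t i j *: (bvec i ⊗ bvec j).
Proof.
apply/matrixP=> k l; rewrite summxE (bigD1 k) //= summxE (bigD1 l) //=.
rewrite !mxE !bcoord_bvec !eqxx !mulr1 big1 ?addr0 => [|j nlj]; last first.
  by rewrite !mxE !bcoord_bvec [l == j]eq_sym (negPf nlj) !mulr0.
rewrite big1 ?addr0 // => i nki; rewrite summxE big1 // => j _.
by rewrite !mxE !bcoord_bvec [k == i]eq_sym (negPf nki) mul0r mulr0.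
Qed.

Lemma tliftE (V W U : vectType F) (f : V -> W -> U) v w :
  bilin f -> tlift f (v ⊗ w) = f v w.
Proof.
move=> bf; rewrite [in RHS](bvec_coord v) (lin_sum _ _ _ (bilinDl bf w)).
apply: eq_bigr => i _; rewrite [in RHS](bvec_coord w).
rewrite (lin_sum _ _ _ (bilinDr bf _)) scaler_sumr.
by apply: eq_bigr => j _; rewrite mxE scalerA.
Qed.

Lemma tens_ext (V W U : vectType F) (f g : tens V W -> U) :
  linear f -> linear g -> (forall v w, f (v ⊗ w) = g (v ⊗ w)) -> f =1 g.
Proof.
move=> lf lg fg t; rewrite (tens_pure t) pair_bigA /= !lin_sum //.
by apply: eq_bigr => -[i j] _ /=; rewrite fg.
Qed.

Lemma ptensPl (V W : vectType F) a (v v' : V) (w : W) :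
  (a *: v + v') ⊗ w = a *: (v ⊗ w) + v' ⊗ w.
Proof. exact: (bilinDl (@ptens_bilin V W)). Qed.

Lemma ptensPr (V W : vectType F) a (v : V) (w w' : W) :
  v ⊗ (a *: w + w') = a *: (v ⊗ w) + v ⊗ w'.
Proof. exact: (bilinDr (@ptens_bilin V W)). Qed.

Lemma tlift_linf (V W U X : vectType F) (f : X -> V -> W -> U) (t : tens V W) :
  (forall v w, linear (fun x => f x v w)) -> linear (fun x => tlift (f x) t).
Proof.
move=> lf a x y; rewrite /tlift scaler_sumr -big_split; apply: eq_bigr => i _.
rewrite /= scaler_sumr -big_split; apply: eq_bigr => j _ /=.
by rewrite lf scalerDr !scalerA mulrC.
Qed.

Lemma tmapE (V W V' W' : vectType F)
    (f : {linear V -> V'}) (g : {linear W -> W'}) v w :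
  tmap f g (v ⊗ w) = f v ⊗ g w.
Proof.
rewrite /tmap tliftE //; split=> [w' a v1 v2|v' a w1 w2] /=.
  by rewrite linearP ptensPl.
by rewrite linearP ptensPr.
Qed.

Lemma tswapE (V W : vectType F) (v : V) (w : W) : tswap (v ⊗ w) = w ⊗ v.
Proof.
rewrite /tswap tliftE //.
by split=> [w' a v1 v2|v' a w1 w2] /=; rewrite (ptensPl, ptensPr).
Qed.

Lemma tassocE (V W U : vectType F) (v : V) (w : W) (u : U) :
  tassoc (v ⊗ w ⊗ u) = v ⊗ (w ⊗ u).
Proof.
rewrite /tassoc !tliftE //.
- by split=> [w' a v1 v2|v' a w1 w2] /=; rewrite ?ptensPl ?ptensPr.
split=> [u' a t1 t2|t]; first by rewrite linearP.
apply: (tlift_linf (f := fun u v w => v ⊗ (w ⊗ u))) => v' w' b x y.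
by rewrite !ptensPr.
Qed.

End TensorProduct.

Notation "v ⊗ w" := (ptens v w) : hopf_scope.

Section TensorAlgebra.
Variables (F : fieldType) (A B : falgType F).

Definition tmul (s t : tens A B) : tens A B :=
  tlift (fun a b => tlift (fun c d => (a * c) ⊗ (b * d)) t) s.

Lemma tmul_bilin : bilin tmul.
Proof.
split=> [t a s s'|s]; first by rewrite /tmul linearP.
apply: (tlift_linf
  (f := fun t a b => tlift (fun c d => (a * c) ⊗ (b * d)) t)) => a b k x y.
by rewrite linearP.
Qed.

Lemma tmulE a b c d : tmul (a ⊗ b) (c ⊗ d) = (a * c) ⊗ (b * d).
Proof.
rewrite /tmul !tliftE //.
  split=> [y k x x'|x k y y'] /=.
    by rewrite mulrDr -scalerAr ptensPl.
  by rewrite mulrDr -scalerAr ptensPr.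
split=> [y|x].
  apply: (tlift_linf (f := fun x c d => (x * c) ⊗ (y * d))) => c' d' k z z'.
  by rewrite mulrDl -scalerAl ptensPl.
apply: (tlift_linf (f := fun y c d => (x * c) ⊗ (y * d))) => c' d' k z z'.
by rewrite mulrDl -scalerAl ptensPr.
Qed.

Let mulL t : linear (tmul^~ t) := bilinDl tmul_bilin t.
Let mulR t : linear (tmul t) := bilinDr tmul_bilin t.

Lemma tmulA : associative tmul.
Proof.
move=> s t u.
apply: (tens_ext (f := fun s => tmul s (tmul t u))
                 (g := fun s => tmul (tmul s t) u)) => [k x y|k x y|a b].
- by rewrite mulL.
- by rewrite !mulL.
apply: (tens_ext (f := fun t => tmul (a ⊗ b) (tmul t u))
                 (g := fun t => tmul (tmul (a ⊗ b) t) u)) => [k x y|k x y|c d].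
- by rewrite mulL mulR.
- by rewrite mulR mulL.
apply: (tens_ext (f := fun u => tmul (a ⊗ b) (tmul (c ⊗ d) u))
                 (g := tmul (tmul (a ⊗ b) (c ⊗ d)))) => [k x y|k x y|e f].
- by rewrite !mulR.
- by rewrite mulR.
by rewrite !tmulE !mulrA.
Qed.

Lemma tmul1l : left_id (1 ⊗ 1) tmul.
Proof.
apply: (tens_ext (g := id)) => [k x y|//|a b]; first by rewrite mulR.
by rewrite tmulE !mul1r.
Qed.

Lemma tmul1r : right_id (1 ⊗ 1) tmul.
Proof.
apply: (tens_ext (f := tmul^~ _) (g := id)) => [k x y|//|a b].
  by rewrite mulL.
by rewrite tmulE !mulr1.
Qed.

Lemma tmulDl : left_distributive tmul +%R.
Proof. by move=> s t u; rewrite -[s]scale1r mulL !scale1r. Qed.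

Lemma tmulDr : right_distributive tmul +%R.
Proof. by move=> s t u; rewrite -[t]scale1r mulR !scale1r. Qed.

Lemma tone_neq0 : 1 ⊗ 1 != 0 :> tens A B.
Proof.
apply/eqP => /matrixP t0.
have h (V : falgType F) : exists i, bcoord i (1 : V) != 0.
  apply/existsP; rewrite -negb_forall; apply/negP => /forallP c0.
  have /eqP[] := oner_neq0 V; rewrite (bvec_coord (1 : V)) big1 // => i _.
  by rewrite (eqP (c0 i)) scale0r.
have [i ni] := h A; have [j nj] := h B.
by have /eqP := t0 i j; rewrite !mxE mulf_eq0 (negPf ni) (negPf nj).
Qed.

HB.instance Definition _ := GRing.Zmodule_isNzRing.Build (tens A B)
  tmulA tmul1l tmul1r tmulDl tmulDr tone_neq0.

Fact tscalerAl (k : F) (s t : tens A B) : k *: (s * t) = (k *: s) * t.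
Proof.
have l0 : tmul 0 t = 0 by exact: (mul0r t).
by have := mulL t k s 0; rewrite l0 !addr0.
Qed.

HB.instance Definition _ :=
  GRing.Lmodule_isLalgebra.Build F (tens A B) tscalerAl.

Fact tscalerAr (k : F) (s t : tens A B) : k *: (s * t) = s * (k *: t).
Proof.
have l0 : tmul s 0 = 0 by exact: (mulr0 s).
by have := mulR s k t 0; rewrite l0 !addr0.
Qed.

HB.instance Definition _ :=
  GRing.Lalgebra_isAlgebra.Build F (tens A B) tscalerAr.
HB.instance Definition _ := Algebra_isFalgebra.Build F (tens A B).

Lemma ptensM (a c : A) (b d : B) : (a ⊗ b) * (c ⊗ d) = (a * c) ⊗ (b * d).
Proof. exact: tmulE. Qed.

End TensorAlgebra.

HB.mixin Record Falgebra_isHopf (F : fieldType) H of Falgebra F H := {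
  comul : {lrmorphism H -> tens H H};
  counit : {lrmorphism H -> F | *%R};
  antipode : {linear H -> H};
  comulA : forall x,
    tassoc (tmap comul idfun (comul x)) = tmap idfun comul (comul x);
  counitl : forall x, tlift (fun a b => counit a *: b) (comul x) = x;
  counitr : forall x, tlift (fun a b => counit b *: a) (comul x) = x;
  antipodel : forall x,
    tlift (fun a b => antipode a * b) (comul x) = (counit x)%:A;
  antipoder : forall x,
    tlift (fun a b => a * antipode b) (comul x) = (counit x)%:A
}.

#[short(type="hopfType")]
HB.structure Definition HopfAlgebra (F : fieldType) :=
  {H of Falgebra_isHopf F H & Falgebra F H}.

Section TensorLemmas.
Variable F : fieldType.

Lemma linear_tlift (V W U X : vectType F) (h : U -> X) (f : V -> W -> U)
    (t : tens V W) : linear h -> h (tlift f t) = tlift (fun v w => h (f v w)) t.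
Proof.
move=> lh; by rewrite /tlift !pair_bigA lin_sum.
Qed.

Lemma tlift_tmap (V W U V' W' : vectType F) (f : {linear V' -> V})
    (g : {linear W' -> W}) (k : V -> W -> U) (t : tens V' W') : bilin k ->
  tlift k (tmap f g t) = tlift (fun v w => k (f v) (g w)) t.
Proof.
move=> bk; rewrite /tmap (linear_tlift (h := tlift k)) => [|a x y]; last by rewrite linearP.
by apply: eq_bigr => i _; apply: eq_bigr => j _; rewrite tliftE.
Qed.

Lemma tlift_exchange (V W V' W' U : vectType F) (s : tens V W) (t : tens V' W')
    (k : V -> W -> V' -> W' -> U) :
  tlift (fun v w => tlift (k v w) t) s
    = tlift (fun v' w' => tlift (fun v w => k v w v' w') s) t.
Proof.
rewrite /tlift !pair_bigA /=.
under eq_bigr do rewrite pair_bigA scaler_sumr.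
rewrite exchange_big; apply: eq_bigr => -[i j] _ /=; rewrite pair_bigA.
rewrite scaler_sumr; apply: eq_bigr => -[l m] _ /=.
by rewrite !scalerA mulrC.
Qed.

Lemma eq_tlift (V W U : vectType F) (f g : V -> W -> U) (t : tens V W) :
  f =2 g -> tlift f t = tlift g t.
Proof.
by move=> fg; apply: eq_bigr => i _; apply: eq_bigr => j _; rewrite fg.
Qed.

(* The linear form f ⊗ g.                                                     *)
Definition tform (V W : vectType F) (f : V -> F) (g : W -> F) : tens V W -> F :=
  tlift (fun v w => f v * g w : F^o).

Lemma tform_linear (V W : vectType F) (f : V -> F) (g : W -> F) :
  linear_for *%R (tform f g).
Proof. by move=> a s t; rewrite /tform linearP. Qed.

Lemma eq_tform (V W : vectType F) (f f' : V -> F) (g g' : W -> F) :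
  f =1 f' -> g =1 g' -> tform f g =1 tform f' g'.
Proof. by move=> ff gg t; apply: (eq_tlift (U := F^o)) => v w; rewrite ff gg. Qed.

Lemma tform_bilin (V W : vectType F) (f : V -> F) (g : W -> F) :
  linear_for *%R f -> linear_for *%R g ->
  bilin (fun v w => f v * g w : F^o).
Proof.
move=> lf lg; split=> [w a v v'|v a w w'] /=; rewrite ?lf ?lg.
  by rewrite mulrDl -mulrA.
by rewrite mulrDr mulrCA.
Qed.

Lemma tformE (V W : vectType F) (f : V -> F) (g : W -> F) v w :
  linear_for *%R f -> linear_for *%R g -> tform f g (v ⊗ w) = f v * g w.
Proof. by move=> lf lg; rewrite /tform tliftE //; apply: tform_bilin. Qed.

Lemma tform_tmap (V W V' W' : vectType F) (f : V -> F) (g : W -> F)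
    (a : {linear V' -> V}) (b : {linear W' -> W}) t :
  linear_for *%R f -> linear_for *%R g ->
  tform f g (tmap a b t) = tform (f \o a) (g \o b) t.
Proof. by move=> lf lg; rewrite /tform tlift_tmap //; apply: tform_bilin. Qed.

Lemma tform_tassoc (V W U : vectType F) (f : V -> F) (g : W -> F) (h : U -> F) t :
  linear_for *%R f -> linear_for *%R g -> linear_for *%R h ->
  tform f (tform g h) (tassoc t) = tform (tform f g) h t.
Proof.
move=> lf lg lh; have lgh := tform_linear g h; have lfg := tform_linear f g.
move: t; apply: (tens_ext (U := F^o) (f := tform f (tform g h) \o @tassoc F V W U)
    (g := tform (tform f g) h)) => [a x y|a x y|s u].
- by rewrite /= linearP tform_linear.
- by rewrite tform_linear.
move: s; apply: (tens_ext (U := F^o)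
    (f := fun s => tform f (tform g h) (tassoc (s ⊗ u)))
    (g := fun s => tform (tform f g) h (s ⊗ u))) => [a x y|a x y|v w].
- by rewrite ptensPl linearP tform_linear.
- by rewrite ptensPl tform_linear.
by rewrite tassocE !tformE // mulrA.
Qed.

End TensorLemmas.

(* The dual Hopf algebra: the product of H^* is the convolution product, its  *)
(* coproduct is the transpose of the product of H.                            *)
Section Dual.
Variables (F : fieldType) (H : hopfType F).

Definition hdual : Type := 'Hom(H, F^o).

HB.instance Definition _ := Vector.copy hdual 'Hom(H, F^o).

Definition dapp (p : hdual) (x : H) : F := (p : 'Hom(H, F^o)) x.

Definition dbasis (i : 'I_(\dim {:H})) : hdual :=
  linfun (bcoord i : H -> F^o).

Definition dmul (p q : hdual) : hdual :=
  linfun (fun x => tform (dapp p) (dapp q) (comul x) : F^o).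

Definition dunit : hdual := linfun (counit : H -> F^o).

Definition dcomul (p : hdual) : tens hdual hdual :=
  \sum_i \sum_j dapp p (bvec i * bvec j) *: (dbasis i ⊗ dbasis j).

Definition dcounit (p : hdual) : F := dapp p 1.

Definition dantipode (p : hdual) : hdual :=
  linfun (fun x : H => dapp p (antipode x) : F^o).

Lemma dapp_is_linear p : linear_for *%R (dapp p).
Proof. by move=> a x y; rewrite /dapp linearP. Qed.

HB.instance Definition _ p := GRing.isLinear.Build F H F *%R (dapp p)
  (dapp_is_linear p).

Lemma dapp_linl x : linear (fun p => dapp p x : F^o).
Proof. by move=> a p q; rewrite /dapp lfunE /= lfunE. Qed.

Lemma dapp_linlZ x k p : dapp (k *: p) x = k * dapp p x.
Proof. by rewrite /dapp lfunE. Qed.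

Lemma dappP p q : dapp p =1 dapp q -> p = q.
Proof. by move=> e; apply/lfunP. Qed.

Lemma dappE (f : H -> F) : linear_for *%R f ->
  dapp (linfun (f : H -> F^o)) =1 f.
Proof.
move=> lf x; rewrite /dapp.
pose g := GRing.isLinear.Build F H F^o *:%R f lf.
pose fl : {linear H -> F^o} := HB.pack f g.
by rewrite (lfunE fl).
Qed.

Lemma dapp_dmul p q x :
  dapp (dmul p q) x = tform (dapp p) (dapp q) (comul x).
Proof.
by rewrite /dmul dappE // => a u v; rewrite linearP tform_linear.
Qed.

Lemma dapp_dunit x : dapp dunit x = counit x.
Proof. by rewrite dappE // => a u v; rewrite linearP. Qed.

Lemma dapp_dantipode p x : dapp (dantipode p) x = dapp p (antipode x).
Proof. by rewrite dappE // => a u v; rewrite !linearP. Qed.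

Lemma dapp_dbasis i x : dapp (dbasis i) x = bcoord i x.
Proof. by rewrite dappE // => a u v; rewrite linearP. Qed.

(* The pairing of H^* ⊗ H^* with H ⊗ H.                                       *)
Definition tev (x y : H) : tens hdual hdual -> F :=
  tform (dapp^~ x) (dapp^~ y).

Lemma tevE x y p q : tev x y (p ⊗ q) = dapp p x * dapp q y.
Proof. by rewrite /tev tformE //; apply: dapp_linl. Qed.

Lemma tev_linear x y : linear_for *%R (tev x y).
Proof. exact: tform_linear. Qed.

Lemma dual_expand p : p = \sum_i dapp p (bvec i) *: dbasis i.
Proof.
apply: dappP => x; rewrite [in LHS](bvec_coord x) linear_sum.
rewrite (lin_sum _ _ _ (dapp_linl x)); apply: eq_bigr => i _.
by rewrite linearZ /= dapp_dbasis mulrC.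
Qed.

Lemma bcoord_dual (i : 'I_(\dim {:hdual})) :
  exists x, forall p, bcoord i p = dapp p x.
Proof.
exists (\sum_j bcoord i (dbasis j) *: bvec j) => p.
rewrite [in LHS](dual_expand p) !linear_sum; apply: eq_bigr => j _.
by rewrite !linearZ /= mulrC.
Qed.

Lemma tens_dualP (V : vectType F) (s t : tens hdual V) :
  (forall x, tlift (fun p v => dapp p x *: v) s
           = tlift (fun p v => dapp p x *: v) t) -> s = t.
Proof.
move=> st; apply/matrixP=> i j; have [x xE] := bcoord_dual i.
have h (r : tens hdual V) :
    bcoord j (tlift (fun p v => dapp p x *: v) r) = r i j.
  rewrite (linear_tlift (h := bcoord j : V -> F^o)); last first.
    by move=> a u v; rewrite linearP.
  rewrite /tlift (bigD1 i) //= [X in _ + X]big1 ?addr0 => [|k ki].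
    rewrite (bigD1 j) //= [X in _ + X]big1 ?addr0 => [|k kj].
      by rewrite linearZ /= -xE !bcoord_bvec !eqxx !mulr1 [LHS]mulr1.
    rewrite linearZ /= bcoord_bvec [j == k]eq_sym (negPf kj) mulr0.
    exact: scaler0.
  rewrite big1 // => l _.
  rewrite linearZ /= -xE (bcoord_bvec i) [i == k]eq_sym (negPf ki) mul0r.
  exact: scaler0.
by rewrite -h st h.
Qed.

Lemma tevP (s t : tens hdual hdual) : (forall x y, tev x y s = tev x y t) -> s = t.
Proof.
move=> st; apply: tens_dualP => x; apply: dappP => y.
have h (r : tens hdual hdual) :
    dapp (tlift (fun p v => dapp p x *: v) r) y = tev x y r.
  rewrite (linear_tlift (h := fun p => dapp p y : F^o)); last exact: dapp_linl.
  by apply: eq_bigr => i _; apply: eq_bigr => j _; rewrite dapp_linlZ.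
by rewrite !h.
Qed.


Lemma tev3P (s t : tens hdual (tens hdual hdual)) :
  (forall x y z, tform (dapp^~ x) (tev y z) s = tform (dapp^~ x) (tev y z) t) ->
  s = t.
Proof.
move=> st; apply: tens_dualP => x; apply: tevP => y z.
have h (r : tens hdual (tens hdual hdual)) :
    tev y z (tlift (fun p v => dapp p x *: v) r) = tform (dapp^~ x) (tev y z) r.
  rewrite (linear_tlift (h := tev y z : _ -> F^o)); last exact: tev_linear.
  apply: (eq_tlift (U := F^o)) => p v; have := tev_linear y z (dapp p x) v 0.
  have := tev_linear y z (-1) 0 0; rewrite scaler0 addr0 mulN1r addNr => ->.
  by rewrite !addr0.
by rewrite !h.
Qed.

Lemma dapp_linear p : linear_for *%R (dapp p).
Proof. exact: dapp_is_linear. Qed.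
Hint Resolve dapp_linear dapp_linl tev_linear tform_linear : core.

Lemma dmulA : associative dmul.
Proof.
move=> p q r; apply: dappP => x; rewrite !dapp_dmul.
transitivity (tform (dapp p) (tform (dapp q) (dapp r))
                (tmap idfun comul (comul x))).
  rewrite tform_tmap //; last exact: tform_linear.
  by apply: eq_tform => // y; rewrite dapp_dmul.
rewrite -comulA tform_tassoc // tform_tmap //; last exact: tform_linear.
by apply: eq_tform => // y; rewrite dapp_dmul.
Qed.

Lemma dmul1l : left_id dunit dmul.
Proof.
move=> p; apply: dappP => x; rewrite dapp_dmul (eq_tform dapp_dunit (fun=> erefl)).
rewrite -[in RHS](counitl x).
rewrite (linear_tlift (h := dapp p : _ -> F^o)); last exact: dapp_linear.
by apply: (eq_tlift (U := F^o)) => a b; rewrite linearZ.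
Qed.

Lemma dmul1r : right_id dunit dmul.
Proof.
move=> p; apply: dappP => x.
rewrite dapp_dmul (eq_tform (fun=> erefl) dapp_dunit) -[in RHS](counitr x).
rewrite (linear_tlift (h := dapp p : _ -> F^o)); last exact: dapp_linear.
by apply: (eq_tlift (U := F^o)) => a b; rewrite linearZ /= mulrC.
Qed.

Lemma dappD p q x : dapp (p + q) x = dapp p x + dapp q x.
Proof. by have := dapp_linl x 1 p q; rewrite !scale1r. Qed.

Lemma dmulPl k p p' q : dmul (k *: p + p') q = k *: dmul p q + dmul p' q.
Proof.
apply: dappP => x; rewrite dapp_linl !dapp_dmul /tform.
rewrite (tlift_linf (U := F^o) (f := fun p a b => dapp p a * dapp q b)) //.
by move=> a b c y z; rewrite dapp_linl mulrDl -mulrA.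
Qed.

Lemma dmulPr k p q q' : dmul p (k *: q + q') = k *: dmul p q + dmul p q'.
Proof.
apply: dappP => x; rewrite dapp_linl !dapp_dmul /tform.
rewrite (tlift_linf (U := F^o) (f := fun q a b => dapp p a * dapp q b)) //.
by move=> a b c y z; rewrite dapp_linl mulrDr mulrCA.
Qed.

Lemma dmulDl : left_distributive dmul +%R.
Proof. by move=> p q r; have := dmulPl 1 p q r; rewrite !scale1r. Qed.

Lemma dmulDr : right_distributive dmul +%R.
Proof. by move=> p q r; have := dmulPr 1 p q r; rewrite !scale1r. Qed.

Lemma dunit_neq0 : dunit != 0.
Proof.
apply/eqP => /(congr1 (dapp^~ 1)); rewrite dapp_dunit rmorph1.
by rewrite /dapp lfunE /= => /eqP; rewrite oner_eq0.
Qed.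

HB.instance Definition _ := GRing.Zmodule_isNzRing.Build hdual
  dmulA dmul1l dmul1r dmulDl dmulDr dunit_neq0.

Fact dscalerAl k (p q : hdual) : k *: (p * q) = (k *: p) * q.
Proof.
have l0 : dmul 0 q = 0 by exact: (mul0r q).
by have := dmulPl k p 0 q; rewrite l0 !addr0.
Qed.

HB.instance Definition _ := GRing.Lmodule_isLalgebra.Build F hdual dscalerAl.

Fact dscalerAr k (p q : hdual) : k *: (p * q) = p * (k *: q).
Proof.
have l0 : dmul p 0 = 0 by exact: (mulr0 p).
by have := dmulPr k p q 0; rewrite l0 !addr0.
Qed.

HB.instance Definition _ := GRing.Lalgebra_isAlgebra.Build F hdual dscalerAr.
HB.instance Definition _ := Algebra_isFalgebra.Build F hdual.

Lemma dappM (p q : hdual) x :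
  dapp (p * q) x = tform (dapp p) (dapp q) (comul x).
Proof. exact: dapp_dmul. Qed.

Lemma tev_dcomul x y p : tev x y (dcomul p) = dapp p (x * y).
Proof.
rewrite /dcomul pair_bigA (lin_sum (U := F^o) (f := tev x y)) /=; last exact: tev_linear.
rewrite [in RHS](bvec_coord x) [in RHS](bvec_coord y).
rewrite mulr_suml linear_sum -[LHS](pair_bigA _
  (fun i j => dapp p (bvec i * bvec j) * tev x y (dbasis i ⊗ dbasis j))) /=.
apply: eq_bigr => i _; rewrite mulr_sumr linear_sum; apply: eq_bigr => j _.
by rewrite tevE !dapp_dbasis -scalerAl -scalerAr !linearZ /= mulrC -mulrA.
Qed.

Lemma dcomul_linear : linear dcomul.
Proof.
move=> k p q; apply: tevP => x y.
by rewrite tev_linear !tev_dcomul dapp_linl.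
Qed.

Lemma tevM x y (s t : tens hdual hdual) :
  tev x y (s * t) = tlift (fun a b => tlift (fun c d =>
    tev a c s * tev b d t : F^o) (comul y)) (comul x).
Proof.
move: s; apply: (tens_ext (U := F^o) (f := fun s => tev x y (s * t))
  (g := fun s => tlift (fun a b => tlift (fun c d =>
    tev a c s * tev b d t : F^o) (comul y)) (comul x))) => [k s s'||p p'].
- by rewrite mulrDl -scalerAl tev_linear.
- apply: (tlift_linf (U := F^o) (f := fun s a b => tlift (fun c d =>
    tev a c s * tev b d t : F^o) (comul y))) => a b.
  apply: (tlift_linf (U := F^o) (f := fun s c d =>
    tev a c s * tev b d t)) => c d k s s'.
  by rewrite tev_linear mulrDl -mulrA.
move: t; apply: (tens_ext (U := F^o) (f := fun t => tev x y ((p ⊗ p') * t))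
  (g := fun t => tlift (fun a b => tlift (fun c d =>
    tev a c (p ⊗ p') * tev b d t : F^o) (comul y)) (comul x))) => [k s s'||q q'].
- by rewrite mulrDr -scalerAr tev_linear.
- apply: (tlift_linf (U := F^o) (f := fun t a b => tlift (fun c d =>
    tev a c (p ⊗ p') * tev b d t : F^o) (comul y))) => a b.
  apply: (tlift_linf (U := F^o) (f := fun t c d =>
    tev a c (p ⊗ p') * tev b d t)) => c d k s s'.
  by rewrite tev_linear mulrDr mulrCA.
rewrite ptensM tevE !dappM mulrC.
rewrite (linear_tlift (h := *%R (tform (dapp p') (dapp q') (comul y)) : F^o -> F^o)).
  apply: (eq_tlift (U := F^o)) => a b; rewrite mulrC.
  rewrite (linear_tlift (h := *%R (dapp p a * dapp q b) : F^o -> F^o)).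
    by apply: (eq_tlift (U := F^o)) => c d; rewrite !tevE mulrACA.
  by move=> k u v; rewrite mulrDr mulrCA.
by move=> k u v; rewrite mulrDr mulrCA.
Qed.

Lemma dcomul_monoid : monoid_morphism dcomul.
Proof.
split.
  apply: tevP => x y; rewrite tev_dcomul tevE.
  by rewrite !dapp_dunit rmorphM.
move=> p q; apply: tevP => x y; rewrite tev_dcomul dappM rmorphM tevM.
rewrite [_ * _]/(tmul _ _) /tmul.
rewrite (linear_tlift (h := tform (dapp p) (dapp q) : _ -> F^o));
  last exact: tform_linear.
apply: (eq_tlift (U := F^o)) => a b.
rewrite (linear_tlift (h := tform (dapp p) (dapp q) : _ -> F^o));
  last exact: tform_linear.
by apply: (eq_tlift (U := F^o)) => c d; rewrite tformE // !tev_dcomul.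
Qed.

HB.instance Definition _ :=
  GRing.isLinear.Build F hdual (tens hdual hdual) *:%R dcomul dcomul_linear.
HB.instance Definition _ :=
  GRing.isMonoidMorphism.Build hdual (tens hdual hdual) dcomul dcomul_monoid.

Lemma dcounit_linear : linear_for *%R dcounit.
Proof. exact: dapp_linl. Qed.

Lemma dcounit_monoid : monoid_morphism dcounit.
Proof.
split=> [|p q]; first by rewrite /dcounit dapp_dunit rmorph1.
by rewrite /dcounit dappM rmorph1 tformE.
Qed.

HB.instance Definition _ :=
  GRing.isLinear.Build F hdual F *%R dcounit dcounit_linear.
HB.instance Definition _ :=
  GRing.isMonoidMorphism.Build hdual F dcounit dcounit_monoid.

Lemma dantipode_linear : linear dantipode.
Proof.
by move=> k p q; apply: dappP => x; rewrite dapp_linl !dapp_dantipode dapp_linl.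
Qed.

HB.instance Definition _ :=
  GRing.isLinear.Build F hdual hdual *:%R dantipode dantipode_linear.

Lemma dcomulA p :
  tassoc (tmap dcomul idfun (dcomul p)) = tmap idfun dcomul (dcomul p).
Proof.
have lin1 x : linear_for *%R (dapp^~ x) by exact: dapp_linl.
apply: tev3P => x y z; rewrite [tev y z in LHS]/tev tform_tassoc //.
rewrite !tform_tmap //; last exact: tform_linear.
transitivity (tev (x * y) z (dcomul p)).
  by apply: eq_tform => // q; rewrite /= -/(tev x y) tev_dcomul.
rewrite tev_dcomul -mulrA -tev_dcomul.
by apply: eq_tform => // q; rewrite /= tev_dcomul.
Qed.

Lemma dapp_tlift (V W : vectType F) (f : V -> W -> hdual) t x :
  dapp (tlift f t) x = tlift (fun v w => dapp (f v w) x : F^o) t.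
Proof.
by rewrite (linear_tlift (h := fun p => dapp p x : F^o)) //; apply: dapp_linl.
Qed.

Lemma tlift_dapp (V W : vectType F) (f : V -> W -> H) t p :
  dapp p (tlift f t) = tlift (fun v w => dapp p (f v w) : F^o) t.
Proof.
by rewrite (linear_tlift (h := dapp p : _ -> F^o)) //; apply: dapp_linear.
Qed.

Lemma dcounitl p : tlift (fun a b => dcounit a *: b) (dcomul p) = p.
Proof.
apply: dappP => x; rewrite dapp_tlift -[in RHS](mul1r x) -tev_dcomul.
by apply: (eq_tlift (U := F^o)) => a b; rewrite dapp_linlZ.
Qed.

Lemma dcounitr p : tlift (fun a b => dcounit b *: a) (dcomul p) = p.
Proof.
apply: dappP => x; rewrite dapp_tlift -[in RHS](mulr1 x) -tev_dcomul.
by apply: (eq_tlift (U := F^o)) => a b; rewrite dapp_linlZ mulrC.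
Qed.

Lemma dantipodel p :
  tlift (fun a b => dantipode a * b) (dcomul p) = (dcounit p)%:A.
Proof.
apply: dappP => x; rewrite dapp_tlift dapp_linlZ dapp_dunit mulrC.
transitivity (dapp p ((counit x)%:A)); last by rewrite linearZ.
rewrite -antipodel tlift_dapp.
under (eq_tlift (U := F^o)) do rewrite dappM /tform.
rewrite tlift_exchange; apply: (eq_tlift (U := F^o)) => a b.
rewrite -tev_dcomul; apply: (eq_tlift (U := F^o)) => q r.
by rewrite dapp_dantipode.
Qed.

Lemma dantipoder p :
  tlift (fun a b => a * dantipode b) (dcomul p) = (dcounit p)%:A.
Proof.
apply: dappP => x; rewrite dapp_tlift dapp_linlZ dapp_dunit mulrC.
transitivity (dapp p ((counit x)%:A)); last by rewrite linearZ.
rewrite -antipoder tlift_dapp.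
under (eq_tlift (U := F^o)) do rewrite dappM /tform.
rewrite tlift_exchange; apply: (eq_tlift (U := F^o)) => a b.
rewrite -tev_dcomul; apply: (eq_tlift (U := F^o)) => q r.
by rewrite dapp_dantipode.
Qed.

HB.instance Definition _ := Falgebra_isHopf.Build F hdual
  dcomulA dcounitl dcounitr dantipodel dantipoder.

End Dual.

Section Grouplike.
Variables (F : fieldType) (H : hopfType F).

Definition grouplike (g : H) : bool :=
  (comul g == g ⊗ g) && (counit g == 1).

Record glike := Glike { gval : H; gvalP : grouplike gval }.

HB.instance Definition _ := [isSub for gval].
HB.instance Definition _ := [Choice of glike by <:].

Lemma grouplike_comul g : grouplike g -> comul g = g ⊗ g.
Proof. by case/andP => /eqP. Qed.

Lemma grouplike_counit g : grouplike g -> counit g = 1.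
Proof. by case/andP => _ /eqP. Qed.

Lemma grouplike1 : grouplike 1.
Proof. by rewrite /grouplike !rmorph1 !eqxx. Qed.

Lemma grouplikeM g h : grouplike g -> grouplike h -> grouplike (g * h).
Proof.
move=> Gg Gh; rewrite /grouplike !rmorphM /= !grouplike_comul //.
by rewrite !grouplike_counit // mulr1 ptensM !eqxx.
Qed.

Lemma grouplikeVl g : grouplike g -> antipode g * g = 1.
Proof.
move=> Gg; have := antipodel g.
rewrite grouplike_counit // scale1r grouplike_comul // tliftE //.
split=> [b k a a'|a k b b'] /=; first by rewrite linearP mulrDl -scalerAl.
by rewrite mulrDr -scalerAr.
Qed.

Lemma grouplikeVr g : grouplike g -> g * antipode g = 1.
Proof.
move=> Gg; have := antipoder g.
rewrite grouplike_counit // scale1r grouplike_comul // tliftE //.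
split=> [b k a a'|a k b b'] /=; first by rewrite mulrDl -scalerAl.
by rewrite linearP mulrDr -scalerAr.
Qed.

Lemma grouplikeV g : grouplike g -> grouplike (antipode g).
Proof.
move=> Gg; have gV := grouplikeVl Gg; have gVr := grouplikeVr Gg.
apply/andP; split; apply/eqP; last first.
  have := rmorphM counit (antipode g) g.
  by rewrite gV rmorph1 /= (grouplike_counit Gg) mulr1.
have c1 : comul (antipode g) * (g ⊗ g) = 1.
  have := rmorphM comul (antipode g) g.
  by rewrite gV rmorph1 /= (grouplike_comul Gg).
rewrite -[LHS]mulr1 (_ : 1 = (g ⊗ g) * (antipode g ⊗ antipode g)).
  by rewrite mulrA c1 mul1r.
by rewrite ptensM gVr.
Qed.

Lemma grouplike_free (s : seq H) : uniq s -> all grouplike s -> free s.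
Proof.
elim: s => [|g s IH] /=; first by rewrite nil_free.
case/andP => sg us /andP[Gg Gs]; have fs := IH us Gs.
rewrite free_cons fs andbT; apply/negP => gs.
pose X := in_tuple s; have gE : g = \sum_i coord X i g *: s`_i.
  exact: (coord_span (X := X) gs).
have GX (i : 'I_(size s)) : grouplike s`_i by apply: (allP Gs); apply: mem_nth.
have cX i : coord X i g *: s`_i = coord X i g *: g.
  have lc : bilin (fun a b => coord X i a *: b : H).
    split=> [b k a a'|a k b b'] /=; first by rewrite linearP scalerDl scalerA.
    by rewrite scalerDr !scalerA mulrC.
  have := tliftE g g lc; rewrite -grouplike_comul // => <-.
  rewrite {2}gE linear_sum linear_sum (bigD1 i) //=.
  rewrite [X in _ = _ + X]big1 ?addr0 => [|j ji].
    rewrite !linearZ /= grouplike_comul // tliftE //.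
    by rewrite (coord_free (X := X) i i fs) eqxx scale1r.
  rewrite !linearZ /= grouplike_comul // tliftE //.
  by rewrite (coord_free (X := X) j i fs) (negPf ji) scale0r scaler0.
have c0 i : coord X i g = 0.
  apply/eqP; apply: contraNT sg => ci; have := cX i.
  by move/(scalerI ci) => <-; apply: mem_nth.
have := grouplike_counit Gg; rewrite gE big1 => [|i _].
  by rewrite linear0 => /eqP; rewrite eq_sym oner_eq0.
by rewrite c0 scale0r.
Qed.

Lemma glike_finite : exists s : seq glike, Finite.axiom s.
Proof.
pose P n := `[< exists s : seq glike, uniq s /\ size s = n >].
have P0 : exists n, P n by exists 0; apply/asboolP; exists [::].
have Pb n : P n -> (n <= \dim {:H})%N.
  move/asboolP => [s [us <-]].
  have fs : free (map gval s).
    apply: grouplike_free; first by rewrite (map_inj_uniq val_inj).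
    by apply/allP => _ /mapP[g _ ->]; apply: gvalP.
  by move: fs; rewrite -(size_map gval) => /eqP <-; rewrite dimvS ?subvf.
case: (ex_maxnP P0 Pb) => m /asboolP[s [us sm]] max; exists s => g.
rewrite count_uniq_mem //; case gs : (g \in s) => //.
have /max : P m.+1 by apply/asboolP; exists (g :: s); rewrite /= gs us sm.
by rewrite ltnn.
Qed.

Definition glike_enum : seq glike := sval (cid glike_finite).

Lemma glike_enumP : Finite.axiom glike_enum.
Proof. exact: svalP (cid glike_finite). Qed.

Lemma glike_pickleK :
  pcancel (index^~ glike_enum) (fun n => onth glike_enum n).
Proof.
move=> g; have gs : g \in glike_enum.
  by rewrite -has_pred1 has_count glike_enumP.
by rewrite onthE (nth_map g) ?nth_index ?index_mem.
Qed.

HB.instance Definition _ := isCountable.Build glike glike_pickleK.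
HB.instance Definition _ := isFinite.Build glike glike_enumP.

Definition glike1 : glike := Glike grouplike1.
Definition glikeM (g h : glike) : glike :=
  Glike (grouplikeM (gvalP g) (gvalP h)).
Definition glikeV (g : glike) : glike := Glike (grouplikeV (gvalP g)).

Lemma glikeMA : associative glikeM.
Proof. by move=> g h k; apply: val_inj; rewrite /= mulrA. Qed.

Lemma glike1M : left_id glike1 glikeM.
Proof. by move=> g; apply: val_inj; rewrite /= mul1r. Qed.

Lemma glikeVM : left_inverse glike1 glikeV glikeM.
Proof. by move=> g; apply: val_inj; rewrite /= grouplikeVl ?gvalP. Qed.

HB.instance Definition _ := Finite_isGroup.Build glike glikeMA glike1M glikeVM.

End Grouplike.

(* Corepresentations: right comodules.                                        *)
Section Corepresentation.
Variables (F : fieldType) (H : hopfType F).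

Record corep := Corep {
  corep_space :> vectType F;
  coact : {linear corep_space -> tens corep_space H};
  coactA : forall v,
    tassoc (tmap coact idfun (coact v)) = tmap idfun comul (coact v);
  coact1 : forall v, tlift (fun w h => counit h *: w) (coact v) = v
}.

Definition subcorep (M : corep) (W : {vspace M}) : Prop :=
  forall w, w \in W -> coact M w \in tensv W {:H}.

Definition irreducible_corep (M : corep) : Prop :=
  ({:M} != 0)%VS /\
  forall W : {vspace M}, subcorep W -> W = 0%VS \/ W = {:M}%VS.

Definition pointed : Prop :=
  forall M : corep, irreducible_corep M -> \dim {:M} = 1%N.

End Corepresentation.

Section DrinfeldDouble.
Variable F : fieldType.

Definition hopf_embedding (A B : hopfType F) (f : {lrmorphism A -> B}) : Prop :=
  [/\ injective f,
      forall x, comul (f x) = tmap f f (comul x),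
      forall x, counit (f x) = counit x
    & forall x, antipode (f x) = f (antipode x)].

(* The embedding of A^cop, A with the opposite coproduct, as a Hopf           *)
(* subalgebra of B. The antipode of A^cop is the inverse of that of A.        *)
Definition cop_hopf_embedding (A B : hopfType F) (f : {lrmorphism A -> B}) :
    Prop :=
  [/\ injective f,
      forall x, comul (f x) = tmap f f (tswap (comul x)),
      forall x, counit (f x) = counit x
    & forall x, antipode (f (antipode x)) = f x].

Section Rmatrix.
Variable D : hopfType F.
Implicit Types R : tens D D.

Definition R12 R : tens (tens D D) D := R ⊗ 1.
Definition R13 R : tens (tens D D) D := tlift (fun a b => a ⊗ 1 ⊗ b) R.
Definition R23 R : tens (tens D D) D := tlift (fun a b => 1 ⊗ a ⊗ b) R.

Definition universal_Rmatrix R : Prop :=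
  [/\ R \is a GRing.unit,
      forall x, R * comul x = tswap (comul x) * R,
      tmap comul idfun R = R13 R * R23 R
    & tmap idfun comul R = tassoc (R13 R * R12 R)].

End Rmatrix.

(* D(H) is determined up to isomorphism by the following data. The families   *)
(* bvec and dbasis are dual bases of H and H^*.                               *)
Record drinfeld_double (H : hopfType F) := DrinfeldDouble {
  double :> hopfType F;
  in_double : {lrmorphism H -> double};
  in_doubled : {lrmorphism hdual H -> double};
  in_doubleP : hopf_embedding in_double;
  in_doubledP : cop_hopf_embedding in_doubled;
  double_bij : bijective
    (tlift (fun p h => in_doubled p * in_double h) :
       tens (hdual H) H -> double);
  double_Rmatrix : universal_Rmatrix
    (\sum_i in_double (bvec i) ⊗ in_doubled (dbasis i))
}.

Definition drinfeld_element (H : hopfType F) (D : drinfeld_double H) : D :=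
  \sum_i antipode (in_doubled D (dbasis i)) * in_double D (bvec i).

Definition unipotent (A : falgType F) (x : A) : Prop :=
  exists2 N : nat, (0 < N)%N & (1 - x) ^+ N = 0.

Definition is_qexp (H : hopfType F) (D : drinfeld_double H) (n : nat) : Prop :=
  [/\ (0 < n)%N,
      unipotent (drinfeld_element D ^+ n)
    & forall m, (0 < m)%N -> unipotent (drinfeld_element D ^+ m) ->
        (n <= m)%N].

(* The value is 0 if no such n exists; 0 is not the exponent of a group.      *)
Definition qexp (H : hopfType F) (D : drinfeld_double H) : nat :=
  xget 0%N [set n | is_qexp D n]%classic.

End DrinfeldDouble.

(* Main.v *)
Require Import Defs.
From HB Require Import structures.
From mathcomp Require Import all_boot all_algebra all_fingroup all_solvable.
From mathcomp Require Import all_field reals complex.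
From mathcomp Require boolp classical_sets.

Set Implicit Arguments.
Unset Strict Implicit.
Unset Printing Implicit Defensive.

(** Write h_i, h^i for dual bases of H and H^*, S for the antipode, u for the
    Drinfeld element, and n for the exponent of G(H).

    Every element of D(H) is [end_double f], the sum of S(h^i) f(h_i), for one
    linear endomorphism f of H. Since u x = S^2(x) u for x in H, right
    multiplication by u corresponds to the operator [tconv] on End(H), which
    sends f to the convolution of id with S^-2 f, and the unit of D(H) to
    [counit_end]. Hence u^m is unipotent if and only if some power of
    1 - tconv^m kills [counit_end] ([unipotent_drinfeldP]): the question is
    moved from the double to H.

    If u^m is unipotent, evaluation at a grouplike g, which S^2 fixes, yields
    that a power of 1 - g^m is 0. As g has finite order and the characteristic
    is 0, g^m = 1 ([unipotent_exponent]); so n divides m.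

    Conversely let H be pointed. The coefficients of the regular corepresentation
    form a matrix c over H with comul c_ij = sum_k c_ik ⊗ c_kj, and since
    irreducible corepresentations have dimension 1, a change of basis makes c
    triangular ([pointed_trig]); its diagonal entries are grouplike. On the
    row i of c, modulo the rows above it, tconv acts by f |-> c_ii S^-2 f. As
    c_ii^n = 1, the operator tconv^n is unipotent as soon as S^2n is
    ([tconv_diff_nilpotent]).

    For that last point, the x in H killed by a power of S^2n - 1 form a
    subalgebra K, stable under S and containing G(H). Triangularity gives
    comul c_ij = c_ii ⊗ c_ij + c_ij ⊗ c_jj + terms in entries closer to the
    diagonal. If those entries are in K, then S^2 acts on c_ij modulo K as
    x |-> a x b with a, b in G(H), so S^2n fixes c_ij modulo K and c_ij is in K
    ([genfix_skew_primitive], [genfix_mult_mx]). *)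

(** * Tensors written as sums of pure tensors *)

Section PureTensors.
Import GRing.Theory.
Local Open Scope ring_scope.
Local Open Scope hopf_scope.
Variable F : fieldType.

Lemma bilin_mul (V W : vectType F) (A : falgType F) (f : {linear V -> A})
    (g : {linear W -> A}) : bilin (fun v w => f v * g w).
Proof.
split=> [w k v v'|v k w w'] /=; rewrite linearP.
  by rewrite mulrDl -scalerAl.
by rewrite mulrDr -scalerAr.
Qed.

Lemma bilin_scalel (V W : vectType F) (l : {linear V -> F | *%R}) :
  bilin (fun (v : V) (w : W) => l v *: w).
Proof.
split=> [w k v v'|v k w w'] /=; first by rewrite linearP scalerDl scalerA.
by rewrite scalerDr !scalerA mulrC.
Qed.

Lemma bilin_scaler (V W : vectType F) (l : {linear W -> F | *%R}) :
  bilin (fun (v : V) (w : W) => l w *: v).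
Proof.
split=> [w k v v'|v k w w'] /=; last by rewrite linearP scalerDl scalerA.
by rewrite scalerDr !scalerA mulrC.
Qed.

Lemma tlift_pure_sum (V W U : vectType F) (f : V -> W -> U) (I : finType)
    (v : I -> V) (w : I -> W) :
  bilin f -> tlift f (\sum_k v k ⊗ w k) = \sum_k f (v k) (w k).
Proof.
by move=> bf; rewrite linear_sum; apply: eq_bigr => k _ /=; rewrite tliftE.
Qed.

Lemma tmap_pure_sum (V W V' W' : vectType F) (f : {linear V -> V'})
    (g : {linear W -> W'}) (I : finType) (v : I -> V) (w : I -> W) :
  tmap f g (\sum_k v k ⊗ w k) = \sum_k f (v k) ⊗ g (w k).
Proof. by rewrite linear_sum; apply: eq_bigr => k _ /=; rewrite tmapE. Qed.

Lemma tassoc_sum (V W U : vectType F) (I : finType)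
    (t : I -> tens (tens V W) U) :
  tassoc (\sum_k t k) = \sum_k tassoc (t k).
Proof. exact: linear_sum. Qed.

Lemma ptens_suml (V W : vectType F) (I : finType) (v : I -> V) (w : W) :
  (\sum_k v k) ⊗ w = \sum_k v k ⊗ w.
Proof.
have := lin_sum (index_enum I) (fun=> 1) v (bilinDl (@ptens_bilin F V W) w).
by under eq_bigr do rewrite scale1r; under [RHS]eq_bigr do rewrite scale1r.
Qed.

Lemma ptens_sumr (V W : vectType F) (I : finType) (v : V) (w : I -> W) :
  v ⊗ (\sum_k w k) = \sum_k v ⊗ w k.
Proof.
have := lin_sum (index_enum I) (fun=> 1) w (bilinDr (@ptens_bilin F V W) v).
by under eq_bigr do rewrite scale1r; under [RHS]eq_bigr do rewrite scale1r.
Qed.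

Lemma ptensZr (V W : vectType F) k (v : V) (w : W) :
  v ⊗ (k *: w) = k *: (v ⊗ w).
Proof. by apply/matrixP => i j; rewrite !mxE linearZ /= mulrCA. Qed.

(** This is how identities in H are read off from identities in V ⊗ H.        *)
Lemma bvec_pure_inj (V W : vectType F) (v w : 'I_(\dim {:V}) -> W) :
  \sum_i bvec i ⊗ v i = \sum_i bvec i ⊗ w i -> v =1 w.
Proof.
have h i (u : 'I_(\dim {:V}) -> W) :
    tlift (fun (a : V) b => bcoord i a *: b) (\sum_i bvec i ⊗ u i) = u i.
  rewrite tlift_pure_sum; last exact: (bilin_scalel _ (bcoord i)).
  rewrite (bigD1 i) //= bcoord_bvec eqxx scale1r big1 ?addr0 //.
  by move=> j ji; rewrite bcoord_bvec eq_sym (negPf ji) scale0r.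
by move=> vw i; rewrite -(h i v) vw h.
Qed.

End PureTensors.

(** * Multiplicative matrices *)

Section MultiplicativeMatrices.
Import GRing.Theory.
Local Open Scope ring_scope.
Local Open Scope hopf_scope.
Variables (F : fieldType) (H : hopfType F).

(** With the two embeddings of H in H ⊗ H as ring morphisms, the defining
    property of a multiplicative matrix is an equation between matrices over
    the ring H ⊗ H, where matrix algebra applies.                             *)
Definition tinl (x : H) : tens H H := x ⊗ 1.
Definition tinr (x : H) : tens H H := 1 ⊗ x.

Lemma tinl_linear : linear tinl.
Proof. by move=> k x y; apply: ptensPl. Qed.
Lemma tinr_linear : linear tinr.
Proof. by move=> k x y; apply: ptensPr. Qed.
Lemma tinl_monoid : monoid_morphism tinl.
Proof. by split=> // x y; rewrite /tinl ptensM mulr1. Qed.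
Lemma tinr_monoid : monoid_morphism tinr.
Proof. by split=> // x y; rewrite /tinr ptensM mulr1. Qed.

HB.instance Definition _ :=
  GRing.isLinear.Build F H (tens H H) *:%R tinl tinl_linear.
HB.instance Definition _ :=
  GRing.isMonoidMorphism.Build H (tens H H) tinl tinl_monoid.
HB.instance Definition _ :=
  GRing.isLinear.Build F H (tens H H) *:%R tinr tinr_linear.
HB.instance Definition _ :=
  GRing.isMonoidMorphism.Build H (tens H H) tinr tinr_monoid.

(** The matrices of coefficients of corepresentations, which take the place of
    Sweedler notation below: a Hopf algebra is spanned by the entries of one of
    them, and for these coassociativity is the associativity of the matrix
    product.                                                                  *)
Definition mult_mx d (c : 'M[H]_d) : Prop :=
  map_mx comul c = map_mx tinl c *m map_mx tinr c /\ map_mx counit c = 1%:M.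

Lemma mult_mx_comul d (c : 'M[H]_d) i j : mult_mx c ->
  comul (c i j) = \sum_k c i k ⊗ c k j.
Proof.
case=> /matrixP/(_ i j) + _; rewrite !mxE => ->; apply: eq_bigr => k _.
by rewrite !mxE /tinl /tinr ptensM mulr1 mul1r.
Qed.

Lemma mult_mx_counit d (c : 'M[H]_d) i j : mult_mx c ->
  counit (c i j) = (i == j)%:R.
Proof. by case=> _ /matrixP/(_ i j); rewrite !mxE. Qed.

Lemma mult_mxP d (c : 'M[H]_d) :
  (forall i j, comul (c i j) = \sum_k c i k ⊗ c k j) ->
  (forall i j, counit (c i j) = (i == j)%:R) -> mult_mx c.
Proof.
move=> hc he; split; apply/matrixP => i j; rewrite !mxE ?hc //.
by apply: eq_bigr => k _; rewrite !mxE /tinl /tinr ptensM mulr1 mul1r.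
Qed.

(** The antipode axioms say that the entrywise antipode of a multiplicative
    matrix is its inverse.                                                    *)
Lemma mult_mx_mulSr d (c : 'M[H]_d) i j : mult_mx c ->
  \sum_k c i k * antipode (c k j) = (i == j)%:R.
Proof.
move=> mc; have := antipoder (c i j); rewrite (mult_mx_comul _ _ mc).
rewrite tlift_pure_sum; last exact: (bilin_mul idfun).
by move=> ->; rewrite (mult_mx_counit _ _ mc) scaler_nat.
Qed.

Lemma mult_mx_mulSl d (c : 'M[H]_d) i j : mult_mx c ->
  \sum_k antipode (c i k) * c k j = (i == j)%:R.
Proof.
move=> mc; have := antipodel (c i j); rewrite (mult_mx_comul _ _ mc).
rewrite tlift_pure_sum; last exact: (bilin_mul _ idfun).
by move=> ->; rewrite (mult_mx_counit _ _ mc) scaler_nat.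
Qed.

(** The coefficients of H as a right comodule over itself.                    *)
Definition comul_mx : 'M[H]_(\dim {:H}) :=
  \matrix_(i, j) \sum_k comul (bvec j) i k *: bvec k.

Lemma comul_bvec j : comul (bvec j) = \sum_i bvec i ⊗ comul_mx i j.
Proof.
rewrite [LHS]tens_pure; apply: eq_bigr => i _; rewrite mxE.
by rewrite (lin_sum _ _ _ (bilinDr (@ptens_bilin _ H H) (bvec i))).
Qed.

Lemma comul_mxP : mult_mx comul_mx.
Proof.
apply: mult_mxP => i j; last first.
  have := counitr (bvec j); rewrite comul_bvec tlift_pure_sum; last first.
    exact: (bilin_scaler _ counit).
  move/(congr1 (bcoord i)); rewrite bcoord_bvec => <-.
  rewrite linear_sum (bigD1 i) //= linearZ /= bcoord_bvec eqxx mulr1.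
  rewrite big1 ?addr0 // => k ki.
  by rewrite linearZ /= bcoord_bvec eq_sym (negPf ki) mulr0.
pose w i := \sum_k comul_mx i k ⊗ comul_mx k j.
apply: (bvec_pure_inj (v := fun i => comul (comul_mx i j)) (w := w)).
have := comulA (bvec j); rewrite comul_bvec !tmap_pure_sum => <-.
rewrite tassoc_sum.
under eq_bigr => k _.
  rewrite /= comul_bvec ptens_suml tassoc_sum.
  under eq_bigr do rewrite tassocE.
  over.
by rewrite exchange_big; apply: eq_bigr => k _; rewrite -ptens_sumr.
Qed.


(** The counit axiom writes each basis vector as a combination of entries of
    [comul_mx], so these entries span H.                                      *)
Lemma comul_mx_ext (V : vectType F) (f g : H -> V) : linear f -> linear g ->
  (forall i j, f (comul_mx i j) = g (comul_mx i j)) -> f =1 g.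
Proof.
move=> lf lg fg x; rewrite (bvec_coord x) !lin_sum //.
apply: eq_bigr => j _; congr (_ *: _).
have := counitl (bvec j); rewrite comul_bvec tlift_pure_sum; last first.
  exact: (bilin_scalel _ counit).
move=> <-.
by rewrite !lin_sum //; apply: eq_bigr => i _; rewrite fg.
Qed.

End MultiplicativeMatrices.

(** * The antipode, and conjugation by the Drinfeld element *)

Section Antipode.
Import GRing.Theory.
Local Open Scope ring_scope.
Local Open Scope hopf_scope.
Variables (F : fieldType).

Lemma sum_deltal (A : nzRingType) d (f : 'I_d -> A) i :
  \sum_j (i == j)%:R * f j = f i.
Proof.
rewrite (bigD1 i) //= eqxx mul1r big1 ?addr0 // => j ji.
by rewrite eq_sym (negPf ji) mul0r.
Qed.

Lemma sum_deltar (A : nzRingType) d (f : 'I_d -> A) i :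
  \sum_j f j * (j == i)%:R = f i.
Proof.
rewrite (bigD1 i) //= eqxx mulr1 big1 ?addr0 // => j ji.
by rewrite (negPf ji) mulr0.
Qed.

Lemma antipode1 (H : hopfType F) : antipode (1 : H) = 1.
Proof. by have := grouplikeVl (grouplike1 H); rewrite mulr1. Qed.

(** The products c_ij b_kl form a multiplicative matrix indexed by pairs. Both
    sides are entries of an inverse of that matrix: the left one of the left
    inverse, the right one of the right inverse.                              *)
Lemma mult_mx_antipodeM (H : hopfType F) d e (c : 'M[H]_d) (b : 'M[H]_e) i r k s :
  mult_mx c -> mult_mx b ->
  antipode (c i r * b k s) = antipode (b k s) * antipode (c i r).
Proof.
move=> mc mb.
have left_inv p q : \sum_j \sum_l antipode (c i j * b k l) * (c j p * b l q) =
    (i == p)%:R * (k == q)%:R.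
  have := antipodel (c i p * b k q); rewrite !rmorphM /= !mult_mx_counit //.
  rewrite (mult_mx_comul _ _ mc) (mult_mx_comul _ _ mb) big_distrlr /=.
  rewrite pair_bigA; under eq_bigr do rewrite ptensM.
  rewrite tlift_pure_sum; last exact: (bilin_mul _ idfun).
  by rewrite pair_bigA /= => ->; rewrite -!natrM scaler_nat.
transitivity (\sum_p \sum_q
   (\sum_j \sum_l antipode (c i j * b k l) * (c j p * b l q)) *
     (antipode (b q s) * antipode (c p r))); last first.
  under eq_bigr => p _.
    under eq_bigr do rewrite left_inv -mulrA.
    rewrite -mulr_sumr sum_deltal.
    over.
  by rewrite sum_deltal.
have right_inv j l : \sum_p \sum_q (c j p * b l q) *
    (antipode (b q s) * antipode (c p r)) = (j == r)%:R * (l == s)%:R.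
  under eq_bigr => p _.
    under eq_bigr do rewrite -mulrA [b l _ * _]mulrA.
    rewrite -mulr_sumr.
    rewrite -mulr_suml mult_mx_mulSr // mulrA mulr_natr mulrnAl -mulr_natr.
    over.
  by rewrite -mulr_suml mult_mx_mulSr.
transitivity (\sum_j \sum_l antipode (c i j * b k l) *
    (\sum_p \sum_q (c j p * b l q) * (antipode (b q s) * antipode (c p r)))).
  under eq_bigr => j _.
    under eq_bigr do rewrite right_inv mulrA.
    rewrite sum_deltar.
    over.
  by rewrite sum_deltar.
rewrite !pair_bigA /=.
under eq_bigr do rewrite pair_bigA mulr_sumr.
rewrite exchange_big; apply: eq_bigr => pq _ /=.
by rewrite pair_bigA mulr_suml; apply: eq_bigr => jl _ /=; rewrite mulrA.
Qed.

Lemma antipodeM (H : hopfType F) (x y : H) :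
  antipode (x * y) = antipode y * antipode x.
Proof.
move: x; apply: (comul_mx_ext (f := fun x => antipode (x * y))
  (g := fun x => antipode y * antipode x)) => [k x x'|k x x'|i r].
- by rewrite mulrDl -scalerAl linearP.
- by rewrite linearP mulrDr -scalerAr.
move: y; apply: (comul_mx_ext (f := fun y => antipode (comul_mx H i r * y))
  (g := fun y => antipode y * antipode _)) => [k y y'|k y y'|j s].
- by rewrite mulrDr -scalerAr linearP.
- by rewrite linearP mulrDl -scalerAl.
exact: mult_mx_antipodeM (comul_mxP H) (comul_mxP H).
Qed.

Definition sqantipode (H : hopfType F) (x : H) : H := antipode (antipode x).

Lemma sqantipode_linear (H : hopfType F) : linear (@sqantipode H).
Proof. by move=> k x y; rewrite /sqantipode !linearP. Qed.

Lemma sqantipode_monoid (H : hopfType F) : monoid_morphism (@sqantipode H).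
Proof. by split=> [|x y]; rewrite /sqantipode ?antipode1 // !antipodeM. Qed.

HB.instance Definition _ (H : hopfType F) :=
  GRing.isLinear.Build F H H *:%R (@sqantipode H) (@sqantipode_linear H).
HB.instance Definition _ (H : hopfType F) :=
  GRing.isMonoidMorphism.Build H H (@sqantipode H) (@sqantipode_monoid H).

(** Applying a ⊗ b |-> S(b) a to R comul(x) = comul^op(x) R, with x an entry of
    a multiplicative matrix c, gives sum_m S(c_ml) u c_km = delta_kl u. Then
    S^2(c_lj), multiplied on the left and summed over l, cancels S(c_ml).     *)
Lemma Rmatrix_sqantipode (D : hopfType F) (R : tens D D)
    (u := tlift (fun a b => antipode b * a) R) :
  (forall x, R * comul x = tswap (comul x) * R) ->
  forall x, u * x = sqantipode x * u.
Proof.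
move=> Rx.
have bu : bilin (fun a b : D => antipode b * a).
  split=> [b k a a'|a k b b'] /=; first by rewrite mulrDr -scalerAr.
  by rewrite linearP mulrDl -scalerAl.
pose rho t : D := tlift (fun a b => antipode b * a) t.
have rho_linear : linear rho by exact: linearP.
have rho_sum d (t : 'I_d -> tens D D) : rho (\sum_k t k) = \sum_k rho (t k).
  exact: linear_sum.
have rhoR t x y : rho (t * (x ⊗ y)) = antipode y * rho t * x.
  move: t; apply: (tens_ext (f := fun t => rho (t * (x ⊗ y)))
    (g := fun t => antipode y * rho t * x)) => [k s t|k s t|a b].
  - by rewrite mulrDl -scalerAl rho_linear.
  - by rewrite rho_linear mulrDr mulrDl -scalerAr -scalerAl.
  by rewrite ptensM /rho !tliftE // antipodeM !mulrA.
have rhoL t x y : rho ((x ⊗ y) * t) =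
    tlift (fun a b => antipode b * (antipode y * x) * a) t.
  move: t; apply: (tens_ext (f := fun t => rho ((x ⊗ y) * t))
    (g := tlift (fun a b => antipode b * (antipode y * x) * a)))
    => [k s t|k s t|a b].
  - by rewrite mulrDr -scalerAr rho_linear.
  - by rewrite linearP.
  rewrite ptensM /rho !tliftE // ?antipodeM ?mulrA //.
  split=> [b' k a' a''|a' k b' b''] /=; first by rewrite mulrDr -scalerAr.
  by rewrite linearP !mulrDl -!scalerAl.
apply: (comul_mx_ext (f := fun x => u * x) (g := fun x => sqantipode x * u))
  => [k x y|k x y|i j].
- by rewrite mulrDr -scalerAr.
- by rewrite linearP mulrDl -scalerAl.
set c := comul_mx D; have mc : mult_mx c := comul_mxP D.
have key k l : \sum_m antipode (c m l) * u * c k m = (k == l)%:R * u.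
  have := congr1 rho (Rx (c k l)).
  rewrite !(mult_mx_comul _ _ mc) mulr_sumr rho_sum.
  under eq_bigr do rewrite rhoR.
  move=> ->; rewrite linear_sum mulr_suml rho_sum /=.
  under eq_bigr do rewrite tswapE rhoL.
  rewrite /tlift exchange_big /= mulr_sumr; apply: eq_bigr => x _.
  rewrite exchange_big /= mulr_sumr; apply: eq_bigr => y _.
  rewrite -scaler_sumr -mulr_suml -mulr_sumr mult_mx_mulSl // -scalerAr.
  by rewrite mulr_natr mulr_natl mulrnAl.
transitivity (\sum_l sqantipode (c l j) *
    \sum_m antipode (c m l) * u * c i m); last first.
  under eq_bigr do rewrite key mulrA.
  rewrite -mulr_suml; congr (_ * _).
  rewrite (bigD1 i) //= eqxx mulr1 big1 ?addr0 // => l li.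
  by rewrite eq_sym (negPf li) mulr0.
under eq_bigr do rewrite mulr_sumr.
rewrite exchange_big /=.
under eq_bigr => m _.
  under eq_bigr do rewrite !mulrA -antipodeM.
  rewrite -!mulr_suml -linear_sum mult_mx_mulSr //.
  rewrite (_ : antipode _ = (m == j)%:R); last first.
    by rewrite -[X in antipode X]scaler_nat linearZ /= antipode1 scaler_nat.
  rewrite -mulrA mulr_natl -mulr_natr -mulrA.
  over.
by rewrite /= -mulr_sumr sum_deltar.
Qed.

End Antipode.

(** * Right multiplication by the Drinfeld element as an operator on End(H) *)

Section TwistedConvolution.
Import GRing.Theory.
Local Open Scope ring_scope.
Local Open Scope hopf_scope.
Variables (F : fieldType).

Lemma lker0_inj (V : vectType F) (f : {linear V -> V}) :
  injective f -> lker (linfun f) == 0%VS.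
Proof. by move=> fi; apply/lker0P => x y; rewrite !lfunE => /fi. Qed.

Variables (H : hopfType F) (D : drinfeld_double H).

(** In D(H) the antipode of H^* is inverted by that of D(H), since H^* is
    embedded with the opposite coproduct. This is where the bijectivity of the
    antipode of H comes from.                                                 *)
Lemma dantipode_inj : injective (@dantipode F H).
Proof.
have [di _ _ dS] := in_doubledP D.
move=> p q pq; have {}pq : antipode p = antipode q := pq.
by apply: di; rewrite -[LHS]dS -[RHS]dS pq.
Qed.

Definition dantipode_inv : 'End(hdual H) :=
  (linfun (@dantipode F H : {linear _ -> _}))^-1%VF.

Lemma dantipode_invK : cancel dantipode_inv (@dantipode F H).
Proof.
move=> p; have := lker0_lfunVK (lker0_inj (f := @dantipode F H) dantipode_inj) p.
by rewrite lfunE.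
Qed.

Lemma antipode_inj : injective (antipode : H -> H).
Proof.
move=> x y Sxy; rewrite (bvec_coord x) (bvec_coord y).
apply: eq_bigr => i _; rewrite -!dapp_dbasis -[dbasis i]dantipode_invK.
by rewrite !dapp_dantipode Sxy.
Qed.

Definition sqinv : 'End(H) := (linfun (@sqantipode F H))^-1%VF.

Lemma sqinvK : cancel (@sqantipode F H) sqinv.
Proof.
have li : injective (@sqantipode F H) by move=> x y /antipode_inj/antipode_inj.
by move=> x; have := lker0_lfunK (lker0_inj li) x; rewrite lfunE.
Qed.

Lemma sqantipodeK : cancel sqinv (@sqantipode F H).
Proof.
have li : injective (@sqantipode F H) by move=> x y /antipode_inj/antipode_inj.
by move=> x; have := lker0_lfunVK (lker0_inj li) x; rewrite lfunE.
Qed.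

Lemma in_double_sqantipode x :
  sqantipode (in_double D x) = in_double D (sqantipode x).
Proof. by have [_ _ _ S] := in_doubleP D; rewrite /sqantipode !S. Qed.

Local Notation u := (drinfeld_element D).

Lemma drinfeld_element_conj (x : H) :
  u * in_double D x = in_double D (sqantipode x) * u.
Proof.
have [_ Rx _ _] := double_Rmatrix D.
have := Rmatrix_sqantipode Rx (in_double D x).
rewrite in_double_sqantipode tlift_pure_sum //.
split=> [b k a a'|a k b b'] /=; first by rewrite mulrDr -scalerAr.
by rewrite linearP mulrDl -scalerAl.
Qed.

Definition conv (g : 'End(H)) (x : H) : H :=
  tlift (fun a b => a * g b) (comul x).

Lemma conv_linear g : linear (conv g).
Proof. by move=> k x y; rewrite /conv !linearP. Qed.

HB.instance Definition _ g :=
  GRing.isLinear.Build F H H *:%R (conv g) (conv_linear g).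

Definition tconv (f : 'End(H)) : 'End(H) := linfun (conv (sqinv \o f)%VF).

Lemma tconv_mult_mx d (c : 'M[H]_d) f i j : mult_mx c ->
  tconv f (c i j) = \sum_k c i k * sqinv (f (c k j)).
Proof.
move=> mc; rewrite lfunE /= /conv (mult_mx_comul _ _ mc).
rewrite tlift_pure_sum; last exact: (bilin_mul idfun).
by apply: eq_bigr => k _; rewrite lfunE.
Qed.

Lemma tconv_grouplike g f : grouplike g -> tconv f g = g * sqinv (f g).
Proof.
move=> Gg; rewrite lfunE /= /conv grouplike_comul // tliftE ?lfunE //.
exact: (bilin_mul idfun).
Qed.

(** The linear isomorphism End(H) = H^* ⊗ H -> D(H) given by the multiplication,
    precomposed with the antipode of D(H) on the factor H^*; it sends id to the
    Drinfeld element.                                                         *)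
Definition end_double (f : 'End(H)) : D :=
  \sum_i antipode (in_doubled D (dbasis i)) * in_double D (f (bvec i)).

Lemma end_doubleB f g : end_double (f - g) = end_double f - end_double g.
Proof.
rewrite /end_double -sumrB; apply: eq_bigr => i _.
by rewrite -mulrBr -linearB /= add_lfunE opp_lfunE.
Qed.

(** Moving u across f(h_i) by S^2 and expanding it, the product becomes the sum
    of S(h^j h^i) h_j S^-2(f(h_i)); the coefficients of h^j h^i on the h^k are
    those of comul h_k, which turns the sum into a convolution.               *)
Lemma end_double_tconv f : end_double (tconv f) = end_double f * u.
Proof.
transitivity (\sum_i \sum_j antipode (in_doubled D (dbasis j * dbasis i)) *
    in_double D (bvec j * sqinv (f (bvec i)))); last first.
  rewrite mulr_suml; apply: eq_bigr => i _.
  rewrite -mulrA -[f _ in RHS]sqantipodeK -drinfeld_element_conj mulrA.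
  rewrite mulr_sumr mulr_suml; apply: eq_bigr => j _.
  by rewrite !rmorphM /= antipodeM !mulrA.
rewrite /end_double; under eq_bigr => k _.
  rewrite lfunE /= /conv /tlift pair_bigA /= linear_sum mulr_sumr.
  under eq_bigr do rewrite linearZ /= -scalerAr lfunE /=.
  over.
rewrite exchange_big [RHS]exchange_big [RHS]pair_bigA.
apply: eq_bigr => -[j i] _ /=.
under eq_bigr do rewrite scalerAl.
rewrite -mulr_suml; congr (_ * _); rewrite [dbasis j * _]dual_expand !linear_sum.
apply: eq_bigr => k _; rewrite !linearZ /=; congr (_ *: _).
rewrite dappM /tform /tlift (bigD1 j) //= [X in _ + X]big1 ?addr0.
  rewrite (bigD1 i) //= [X in _ + X]big1 ?addr0 => [|l li].
    by rewrite !dapp_dbasis !bcoord_bvec !eqxx mulr1 [RHS]mulr1.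
  by rewrite !dapp_dbasis !bcoord_bvec [i == l]eq_sym (negPf li) mulr0 scaler0.
move=> l lj; rewrite big1 // => m _.
by rewrite !dapp_dbasis !bcoord_bvec [j == l]eq_sym (negPf lj) mul0r scaler0.
Qed.

(** S(h^i) in D(H) is the image of the inverse dual antipode of h^i, and
    evaluating that form at S(x) recovers h^i(x).                             *)
Lemma end_double_eq0 f : end_double f = 0 -> f = 0.
Proof.
move=> kf0; have [_ _ _ dS] := in_doubledP D.
have bm := bilin_mul (in_doubled D) (in_double D).
have be x : bilin (fun (p : hdual H) (v : H) => dapp p x *: v).
  split=> [v k p p'|p k v v'] /=; first by rewrite dapp_linl scalerDl scalerA.
  by rewrite scalerDr !scalerA mulrC.
pose t := \sum_i dantipode_inv (dbasis i) ⊗ f (bvec i).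
have t0 : t = 0.
  apply: (bij_inj (double_bij D)); rewrite linear0 /t tlift_pure_sum // -[RHS]kf0.
  apply: eq_bigr => i _; rewrite -dS; congr (antipode (in_doubled D _) * _).
  exact: dantipode_invK.
apply/lfunP => x; rewrite zero_lfunE [in LHS](bvec_coord x) linear_sum.
have := tlift_pure_sum (fun i => dantipode_inv (dbasis i)) (fun i => f (bvec i))
  (be (antipode x)).
rewrite -/t t0 linear0 => e; rewrite [RHS]e; apply: eq_bigr => i _.
by rewrite linearZ /= -dapp_dantipode dantipode_invK dapp_dbasis.
Qed.

(** The unit of the convolution algebra End(H).                               *)
Definition counit_end : 'End(H) := linfun (fun x : H => (counit x)%:A : H).

Lemma counit_endE x : counit_end x = (counit x)%:A.
Proof.
have l : linear (fun x : H => (counit x)%:A : H).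
  by move=> k y z; rewrite linearP scalerDl scalerA.
pose g := GRing.isLinear.Build F H H *:%R _ l.
pose fl : {linear H -> H} := HB.pack (fun x : H => (counit x)%:A : H) g.
by rewrite /counit_end (lfunE fl).
Qed.

Lemma end_double_counit : end_double counit_end = 1.
Proof.
rewrite /end_double; under eq_bigr do rewrite counit_endE linearZ rmorph1 -scalerAr mulr1.
under eq_bigr do rewrite -[counit (bvec _)]dapp_dunit -!linearZ.
by rewrite -!linear_sum -dual_expand -[dunit H]/(1 : hdual H) rmorph1 antipode1.
Qed.

Definition tconv_diff m (f : 'End(H)) : 'End(H) := f - iter m tconv f.

Lemma end_double_tconv_diff m N f :
  end_double (iter N (tconv_diff m) f) = end_double f * (1 - u ^+ m) ^+ N.
Proof.
have it k g : end_double (iter k tconv g) = end_double g * u ^+ k.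
  elim: k => [|k IH]; first by rewrite expr0 mulr1.
  by rewrite iterS end_double_tconv IH exprSr mulrA.
elim: N => [|N IH]; first by rewrite expr0 mulr1.
by rewrite iterS /tconv_diff end_doubleB it -/(tconv_diff m) IH exprSr mulrA mulrBr mulr1.
Qed.

Lemma unipotent_drinfeldP m : unipotent (u ^+ m) <->
  exists2 N, (0 < N)%N & iter N (tconv_diff m) counit_end = 0.
Proof.
have kE N : end_double (iter N (tconv_diff m) counit_end) = (1 - u ^+ m) ^+ N.
  by rewrite end_double_tconv_diff end_double_counit mul1r.
split=> -[N N0 h]; exists N => //; first by apply: end_double_eq0; rewrite kE.
by rewrite -kE h /end_double big1 // => i _; rewrite zero_lfunE linear0 mulr0.
Qed.

End TwistedConvolution.

(** * Triangular multiplicative matrices in pointed Hopf algebras *)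

Section Triangularisation.
Import GRing.Theory.
Local Open Scope ring_scope.
Local Open Scope hopf_scope.
Variables (F : fieldType) (H : hopfType F).
Local Notation scal := (map_mx (in_alg H)).

Lemma mult_mx_conj d e (c : 'M[H]_d) (P : 'M[F]_(e, d)) (Q : 'M[F]_(d, e)) :
  Q *m P = 1%:M -> P *m Q = 1%:M -> mult_mx c ->
  mult_mx (scal P *m c *m scal Q).
Proof.
move=> QP PQ [mc ec].
have scal_map (f : {lrmorphism H -> tens H H}) m n (M : 'M[F]_(m, n)) :
    map_mx f (scal M) = map_mx (in_alg (tens H H)) M.
  by apply/matrixP => i j; rewrite !mxE linearZ /= rmorph1.
split; last first.
  rewrite !map_mxM ec mulmx1 -[RHS]PQ; congr (_ *m _);
    by apply/matrixP => i j; rewrite !mxE /= linearZ /= rmorph1 mulr1.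
have QP' : map_mx (in_alg (tens H H)) Q *m map_mx (in_alg _) P = 1%:M.
  by rewrite -map_mxM QP map_mx1.
rewrite !map_mxM !scal_map mc -![in RHS]mulmxA.
by rewrite [map_mx _ Q *m (_ *m _)]mulmxA QP' mul1mx !mulmxA.
Qed.

Lemma mult_mx_block d e (a : 'M[H]_d) (b : 'M[H]_(e, d)) (c : 'M[H]_e) :
  mult_mx (block_mx a 0 b c) -> mult_mx a /\ mult_mx c.
Proof.
case; rewrite !map_block_mx mulmx_block !map_mx0 !mul0mx !mulmx0 !addr0 !add0r.
move=> /eq_block_mx[ha _ _ hc].
rewrite scalar_mx_block => /eq_block_mx[ea _ _ ec].
by split; split.
Qed.

Section MatrixCorep.
Variables (d : nat) (c : 'M[H]_d).

(** The corepresentation with matrix c: e_j |-> sum_i e_i ⊗ c_ij.             *)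
Definition mx_coact (v : 'cV[F]_d) : tens 'cV[F]_d H :=
  \sum_i delta_mx i 0 ⊗ (c *m scal v) i 0.

Lemma mx_coact_linear : linear mx_coact.
Proof.
move=> k v w; rewrite /mx_coact scaler_sumr -big_split /=.
apply: eq_bigr => i _; rewrite -ptensPr; congr (_ ⊗ _).
rewrite !mxE scaler_sumr -big_split; apply: eq_bigr => j _ /=.
by rewrite !mxE /= scalerDl mulrDr -scalerA -scalerAr.
Qed.

HB.instance Definition _ := GRing.isLinear.Build F 'cV[F]_d (tens 'cV[F]_d H)
  *:%R mx_coact mx_coact_linear.

Lemma mx_coact_delta i : mx_coact (delta_mx i 0) = \sum_k delta_mx k 0 ⊗ c k i.
Proof.
apply: eq_bigr => k _; congr (_ ⊗ _); rewrite mxE (bigD1 i) //= big1 ?addr0.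
  by rewrite !mxE !eqxx /= scale1r mulr1.
by move=> j ji; rewrite !mxE (negPf ji) /= scale0r mulr0.
Qed.

Hypothesis mc : mult_mx c.

Lemma mx_coactA v :
  tassoc (tmap mx_coact idfun (mx_coact v)) = tmap idfun comul (mx_coact v).
Proof.
rewrite !tmap_pure_sum tassoc_sum.
under eq_bigr => k _.
  rewrite /= mx_coact_delta ptens_suml tassoc_sum.
  under eq_bigr do rewrite tassocE.
  over.
rewrite exchange_big; apply: eq_bigr => k _ /=; rewrite -ptens_sumr.
congr (_ ⊗ _); rewrite mxE linear_sum /=.
under eq_bigr do rewrite mxE ptens_sumr.
rewrite exchange_big; apply: eq_bigr => j _ /=.
rewrite !mxE -scalerAr mulr1 linearZ /= (mult_mx_comul _ _ mc) scaler_sumr.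
by apply: eq_bigr => l _; rewrite -scalerAr mulr1 ptensZr.
Qed.

Lemma mx_coact1 v : tlift (fun w h => counit h *: w) (mx_coact v) = v.
Proof.
rewrite tlift_pure_sum; last exact: (bilin_scaler _ counit).
apply/colP => i; rewrite summxE (bigD1 i) //= big1.
  rewrite !mxE !eqxx mulr1 addr0 linear_sum /= (bigD1 i) //= big1.
    rewrite !mxE -scalerAr mulr1 linearZ /= (mult_mx_counit _ _ mc) eqxx.
    by rewrite mulr1 addr0.
  move=> j ji; rewrite !mxE -scalerAr mulr1 linearZ /= (mult_mx_counit _ _ mc).
  by rewrite eq_sym (negPf ji) mulr0.
by move=> j ji; rewrite !mxE eq_sym (negPf ji) mulr0.
Qed.

Definition mx_corep : corep H := Corep mx_coactA mx_coact1.

End MatrixCorep.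

Lemma tlift_tensv0 (V U : vectType F) (W : {vspace V}) (l : {linear V -> F | *%R})
    (t : tens V U) :
  (forall v, v \in W -> l v = 0) -> t \in tensv W {:U} ->
  tlift (fun v h => l v *: h) t = 0.
Proof.
move=> lW tW; pose L := linfun (tlift (fun (v : V) (h : U) => l v *: h)).
suff : t \in lker L by rewrite memv_ker lfunE => /eqP.
apply: subvP tW; apply/span_subvP => _ /allpairsP[[a b] [/= aW _ ->]].
rewrite memv_ker lfunE /= tliftE; last exact: (bilin_scalel _ l).
by rewrite lW ?scale0r // vbasis_mem.
Qed.

(** In a basis formed by a basis of a complement of W followed by one of W, the
    coaction of a vector of W has no component on the complement. With W last
    the resulting matrix is lower block triangular.                           *)
Lemma subcorep_block d (c : 'M[H]_d) (mc : mult_mx c) (W : {vspace 'cV[F]_d})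
    (r := \dim W^C) (s := \dim W) :
  @subcorep F H (mx_corep mc) W ->
  exists (P : 'M[F]_(r + s, d)) (Q : 'M[F]_(d, r + s)),
    [/\ Q *m P = 1%:M, P *m Q = 1%:M &
      exists (a : 'M[H]_r) (b : 'M[H]_(s, r)) (e : 'M[H]_s),
        scal P *m c *m scal Q = block_mx a 0 b e].
Proof.
move=> sW; pose X := [tuple of vbasis W^C ++ vbasis W].
have bX : basis_of {:'cV[F]_d} X.
  rewrite -(addv_complf W) addvC; apply: cat_basis; rewrite ?vbasisP //.
  by apply/directv_addP; rewrite capvC capv_compl.
have fX := basis_free bX.
pose P : 'M[F]_(r + s, d) := \matrix_(j, i) coord X j (delta_mx i 0).
pose Q : 'M[F]_(d, r + s) := \matrix_(i, j) X`_j i 0.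
have cvE (v : 'cV[F]_d) : v = \sum_i v i 0 *: delta_mx i 0.
  rewrite [LHS]matrix_sum_delta; apply: eq_bigr => i _.
  by rewrite big_ord1.
have XW (k : 'I_s) : X`_(rshift r k) = (vbasis W)`_k.
  by rewrite nth_cat size_tuple ltnNge leq_addr /= addKn.
have coordW (j : 'I_r) v : v \in W -> coord X (lshift s j) v = 0.
  move=> /coord_vbasis ->; rewrite linear_sum big1 // => k _.
  by rewrite linearZ /= -XW (coord_free _ _ fX) eq_rlshift mulr0.
exists P, Q; split.
- apply/matrixP => i k; rewrite !mxE.
  have := coord_basis bX (memvf (delta_mx k 0)) => /matrixP/(_ i 0).
  rewrite !mxE eqxx andbT => ->; rewrite summxE; apply: eq_bigr => j _.
  by rewrite !mxE mulrC.
- apply/matrixP => j k; rewrite !mxE eq_sym -(coord_free k j fX) [X`_k in RHS]cvE.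
  by rewrite linear_sum; apply: eq_bigr => i _; rewrite linearZ !mxE mulrC.
pose M := scal P *m c *m scal Q; exists (ulsubmx M), (dlsubmx M), (drsubmx M).
rewrite -[LHS]submxK -/M; congr block_mx; apply/matrixP => j k.
transitivity ((scal P *m (c *m scal Q)) (lshift s j) (rshift r k)).
  by rewrite mulmxA !mxE.
have kW : X`_(rshift r k) \in W.
  by rewrite XW; apply/vbasis_mem/mem_nth; rewrite size_tuple.
have := tlift_tensv0 (l := coord X (lshift s j)) (coordW j) (sW _ kW).
rewrite tlift_pure_sum => [t0|]; last first.
  exact: (bilin_scalel _ (coord X (lshift s j))).
rewrite [RHS]mxE -[RHS]t0 mxE; apply: eq_bigr => i _.
rewrite !mxE -scalerAl mul1r; congr (_ *: _).
by apply: eq_bigr => l _; rewrite !mxE.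
Qed.


(** Induction on the size. If the corepresentation of c is irreducible, its
    dimension is 1. If not, a proper subcorepresentation makes c block
    triangular with smaller multiplicative diagonal blocks, those of the
    quotient and of the sub, and conjugating by the block diagonal of their
    changes of basis keeps the upper right block 0.                           *)
Lemma mult_mx_trig d (c : 'M[H]_d) : pointed H -> mult_mx c ->
  exists r (P : 'M[F]_(r, d)) (Q : 'M[F]_(d, r)),
    [/\ Q *m P = 1%:M, P *m Q = 1%:M & is_trig_mx (scal P *m c *m scal Q)].
Proof.
move=> pH; have [n] := ubnP d; elim: n d c => // n IH d c; rewrite ltnS => dn mc.
have [d0|d0] := posnP d.
  exists d, 1%:M, 1%:M; rewrite mulmx1; split=> //; apply/is_trig_mxP => i j.
  by exfalso; have := leq_ltn_trans (leq0n i) (ltn_ord i); rewrite d0.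
have dM : \dim {: mx_corep mc} = d.
  by rewrite dimvf /= /dim /= muln1.
have [irr|red] := boolp.EM (irreducible_corep (mx_corep mc)).
  have d1 := pH _ irr; rewrite dM in d1.
  exists d, 1%:M, 1%:M; rewrite mulmx1; split=> //; apply/is_trig_mxP => i j.
  move=> ij; exfalso.
  have := leq_ltn_trans (leq_ltn_trans (leq0n i) ij) (ltn_ord j).
  by rewrite d1.
have [W [sW W0 WT]] : exists W : {vspace 'cV[F]_d},
    [/\ @subcorep F H (mx_corep mc) W, W != 0%VS & W != fullv].
  apply: boolp.contrapT => nW; apply: red; split.
    by rewrite -dimv_eq0 dM -lt0n.
  move=> W sW; apply: boolp.contrapT => /boolp.not_orP[/eqP W0 /eqP WT].
  by apply: nW; exists W.
have [P [Q [QP PQ [a [b [e cE]]]]]] := subcorep_block sW.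
have [ma me] : mult_mx a /\ mult_mx e.
  by apply: (mult_mx_block (b := b)); rewrite -cE; apply: mult_mx_conj.
have rs : (\dim W^C + \dim W)%N = d.
  by rewrite dimv_compl dM subnK // -[X in (_ <= X)%N]dM dimvS ?subvf.
have W0' : (0 < \dim W)%N by rewrite lt0n dimv_eq0.
have WC0 : (0 < \dim W^C)%N.
  rewrite lt0n; apply: contra WT => /eqP WC; rewrite eqEdim subvf.
  rewrite -[X in (X <= _)%N]/(\dim {:mx_corep mc}) dM -[X in (X <= _)%N]rs WC.
  by rewrite add0n leqnn.
have [|r1 [P1 [Q1 [QP1 PQ1 t1]]]] := IH _ a _ ma.
  by apply: leq_trans dn; rewrite -[X in (_ < X)%N]rs -addn1 leq_add2l.
have [|r2 [P2 [Q2 [QP2 PQ2 t2]]]] := IH _ e _ me.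
  by apply: leq_trans dn; rewrite -[X in (_ < X)%N]rs -add1n leq_add2r.
exists (r1 + r2)%N, (block_mx P1 0 0 P2 *m P), (Q *m block_mx Q1 0 0 Q2); split.
- rewrite !mulmxA -[Q *m _ *m _]mulmxA mulmx_block QP1 QP2.
  by rewrite !mulmx0 !mul0mx !addr0 !add0r -scalar_mx_block mulmx1.
- rewrite !mulmxA -[_ *m P *m Q]mulmxA PQ mulmx1 mulmx_block PQ1 PQ2.
  by rewrite !mulmx0 !mul0mx !addr0 !add0r -scalar_mx_block.
rewrite !map_mxM /= !mulmxA -[_ *m scal P *m c]mulmxA.
rewrite -[_ *m (scal P *m c) *m _]mulmxA cE.
rewrite !map_block_mx !map_mx0 !mulmx_block !mulmx0 !mul0mx !addr0 !add0r.
by rewrite is_trig_block_mx // mul0mx eqxx /= t1 t2.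
Qed.


Lemma pointed_trig : pointed H ->
  exists r (c : 'M[H]_r), [/\ mult_mx c, is_trig_mx c &
    forall W : {vspace H}, (forall i j, c i j \in W) -> forall x, x \in W].
Proof.
move=> pH; have [r [P [Q [QP PQ tc]]]] := mult_mx_trig pH (comul_mxP H).
exists r, (scal P *m comul_mx H *m scal Q); split=> //.
  exact: mult_mx_conj (comul_mxP H).
set c := _ *m scal Q => W cW x.
have cE : comul_mx H = scal Q *m c *m scal P.
  rewrite !mulmxA -[LHS]mul1mx -[LHS]mulmx1 -!map_mxM QP map_mx1 !mul1mx.
  by rewrite -mulmxA -map_mxM QP map_mx1.
clearbody c; have -> : x = projv W x; last exact: memv_proj.
move: x; apply: (comul_mx_ext (f := id)) => [//|k x y|i j].
  by rewrite linearP.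
rewrite projv_id // cE mxE; apply: memv_suml => k _; rewrite !mxE -scalerAr mulr1.
apply/memvZ/memv_suml => l _; rewrite !mxE -scalerAl mul1r; exact: memvZ.
Qed.

End Triangularisation.

(** * Elements on which a power of an algebra endomorphism minus 1 vanishes *)

Section GeneralisedFixedPoints.
Import GRing.Theory.
Local Open Scope ring_scope.
Variables (F : fieldType) (A : falgType F) (s : {lrmorphism A -> A}).

Definition moved (x : A) : A := s x - x.

Lemma moved_linear : linear moved.
Proof. by move=> k x y; rewrite /moved linearP scalerBr opprD addrACA. Qed.

HB.instance Definition _ := GRing.isLinear.Build F A A *:%R moved moved_linear.

Lemma iter_moved0 m : iter m moved 0 = 0.
Proof. by elim: m => //= m ->; rewrite linear0. Qed.

Lemma iter_movedP m k x y :
  iter m moved (k *: x + y) = k *: iter m moved x + iter m moved y.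
Proof. by elim: m => //= m ->; rewrite linearP. Qed.

(** The generalised eigenspace of s for the eigenvalue 1.                     *)
Definition genfix (x : A) : Prop := exists m, iter m moved x = 0.

Lemma genfix_fixed x : s x = x -> genfix x.
Proof. by move=> sx; exists 1%N; rewrite /= /moved sx subrr. Qed.

Lemma genfix0 : genfix 0.
Proof. by exists 0%N. Qed.

Lemma genfix_lin k x y : genfix x -> genfix y -> genfix (k *: x + y).
Proof.
move=> [m mx] [p py]; exists (m + p)%N; rewrite iter_movedP [in X in _ + X]iterD py.
by rewrite addnC iterD mx !iter_moved0 scaler0 addr0.
Qed.

Lemma genfixD x y : genfix x -> genfix y -> genfix (x + y).
Proof. by move=> /(genfix_lin 1) h /h; rewrite scale1r. Qed.

Lemma genfixN x : genfix x -> genfix (- x).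
Proof. by move=> /(genfix_lin (-1)) /(_ genfix0); rewrite addr0 scaleN1r. Qed.

Lemma genfix_sum (I : finType) (Q : pred I) (f : I -> A) :
  (forall i, Q i -> genfix (f i)) -> genfix (\sum_(i | Q i) f i).
Proof. by move=> h; apply: (big_ind genfix) => //; [apply: genfix0 | apply: genfixD]. Qed.

Lemma genfix_moved x : genfix (moved x) -> genfix x.
Proof. by case=> m mx; exists m.+1; rewrite iterSr. Qed.

(** s(xy) - xy is a sum of three products in each of which a factor has been
    moved once more, so induction on the sum of the two nilpotency orders
    applies.                                                                  *)
Lemma genfixM x y : genfix x -> genfix y -> genfix (x * y).
Proof.
move=> [m mx] [p py]; have [n] := ubnP (m + p); elim: n m p x y mx py => // n IH.
case=> [|m] [|p] x y; rewrite ?iterSr => mx py mpn.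
- by rewrite [x]mx mul0r; apply: genfix0.
- by rewrite [x]mx mul0r; apply: genfix0.
- by rewrite [y]py mulr0; apply: genfix0.
apply: genfix_moved.
have -> : moved (x * y) = moved x * moved y + moved x * y + x * moved y.
  rewrite /moved rmorphM /= -mulrDr subrK mulrBl mulrBr addrA subrK //.
rewrite !addSn !addnS !ltnS in mpn.
apply: genfixD; first apply: genfixD.
- by apply: (IH m p) => //; apply: ltnW.
- by apply: (IH m p.+1); rewrite ?iterSr // addnS.
- by apply: (IH m.+1 p); rewrite ?iterSr // addSn.
Qed.

Lemma genfix_comm (f : {linear A -> A}) x :
  (forall y, f (s y) = s (f y)) -> genfix x -> genfix (f x).
Proof.
move=> fs [m mx]; exists m; rewrite -[RHS](linear0 f) -mx.
by elim: m {mx} => //= m ->; rewrite /moved linearB fs.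
Qed.

End GeneralisedFixedPoints.

(** * Unipotency of a power of the square of the antipode *)

Section SquareOfAntipode.
Import GRing.Theory.
Local Open Scope ring_scope.
Local Open Scope hopf_scope.
Variables (F : fieldType) (H : hopfType F).
Variable n : nat.

Fact iter_sqantipode_linear : linear (iter n (@sqantipode F H)).
Proof. elim: n => [|m IH] k x y; first by []. by rewrite !iterS IH linearP. Qed.

Fact iter_sqantipode_monoid : monoid_morphism (iter n (@sqantipode F H)).
Proof.
elim: n => [|m [IH1 IHM]]; first by [].
by split=> [|x y]; rewrite !iterS (IH1, IHM) (rmorph1, rmorphM).
Qed.

HB.instance Definition _ :=
  GRing.isLinear.Build F H H *:%R (iter n (@sqantipode F H)) iter_sqantipode_linear.
HB.instance Definition _ := GRing.isMonoidMorphism.Build H H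
  (iter n (@sqantipode F H)) iter_sqantipode_monoid.

Local Notation s := (iter n (@sqantipode F H) : {lrmorphism H -> H}).

Lemma grouplikeX m (g : H) : grouplike g -> grouplike (g ^+ m).
Proof.
move=> Gg; elim: m => [|m IH]; first exact: grouplike1.
by rewrite exprS; apply: grouplikeM.
Qed.

Lemma sqantipode_grouplike (g : H) : grouplike g -> sqantipode g = g.
Proof.
move=> Gg; have Sg := grouplikeV Gg.
by rewrite /sqantipode -[LHS]mulr1 -(grouplikeVl Gg) mulrA (grouplikeVl Sg) mul1r.
Qed.

Lemma iter_sqantipode_grouplike g : grouplike g -> iter n (@sqantipode F H) g = g.
Proof. by move=> Gg; elim: n => //= m ->; apply: sqantipode_grouplike. Qed.

Lemma genfix_grouplike g : grouplike g -> genfix s g.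
Proof. by move=> Gg; apply: genfix_fixed; apply: iter_sqantipode_grouplike. Qed.

Lemma genfix_antipode x : genfix s x -> genfix s (antipode x).
Proof.
apply: genfix_comm => y /=; elim: n => //= m IH.
by rewrite -IH.
Qed.

Hypothesis exp_n : forall g : H, grouplike g -> g ^+ n = 1.

(** The hypothesis is the antipode axiom for an x with coproduct
    g ⊗ x + x ⊗ h, up to generalised fixed points. It gives S(x) = - g^-1 x h^-1
    modulo K, hence S^2(x) = a x b modulo K with a = h g^-1 and b = h^-1 g.
    G(H) need not be abelian, so a and b are in general not inverse to each
    other; what makes S^2n fix x modulo K is that a^n = b^n = 1.              *)
Lemma genfix_skew_primitive (g h x : H) : grouplike g -> grouplike h ->
  genfix s (g * antipode x + x * antipode h) -> genfix s x.
Proof.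
move=> Gg Gh kx; have GSg := grouplikeV Gg; have GSh := grouplikeV Gh.
pose a := h * antipode g; pose b := antipode h * g.
have Ga : grouplike a by apply: grouplikeM.
have Gb : grouplike b by apply: grouplikeM.
have kS : genfix s (antipode x + antipode g * x * antipode h).
  have := genfixM (genfix_grouplike GSg) kx.
  by rewrite mulrDr !mulrA grouplikeVl // mul1r.
have kS2 : genfix s (sqantipode x - a * x * b).
  have -> : sqantipode x - a * x * b =
      antipode (antipode x + antipode g * x * antipode h) -
      h * (antipode x + antipode g * x * antipode h) * g.
    rewrite linearD /= !antipodeM -/(sqantipode g) -/(sqantipode h).
    rewrite (sqantipode_grouplike Gg) (sqantipode_grouplike Gh) mulrDr mulrDl.
    by rewrite /a /b !mulrA opprD addrA addrK.
  apply: genfixD; first exact: genfix_antipode.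
  by apply/genfixN/genfixM; [apply: genfixM|]; rewrite //; apply: genfix_grouplike.
clearbody a b.
have key m : genfix s (iter m (@sqantipode F H) x - a ^+ m * x * b ^+ m).
  elim: m => [|m IH]; first by rewrite mulr1 mul1r subrr; apply: genfix0.
  have {}IH := genfix_antipode (genfix_antipode IH).
  have := genfixD IH (genfixM (genfixM (genfix_grouplike (grouplikeX m Ga)) kS2)
            (genfix_grouplike (grouplikeX m Gb))).
  rewrite -/(sqantipode _) iterS linearB /= !rmorphM /=.
  rewrite (sqantipode_grouplike (grouplikeX m Ga)).
  rewrite (sqantipode_grouplike (grouplikeX m Gb)) mulrBr mulrBl !mulrA addrA.
  by rewrite subrK -exprSr -[_ * b ^+ m]mulrA -exprS.
apply: (genfix_moved (s := s)); rewrite /moved /= -opprB; apply: genfixN.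
rewrite -opprB; apply: genfixN.
by have := key n; rewrite !exp_n // mul1r mulr1.
Qed.

(** In comul c_ii = sum_k c_ik ⊗ c_ki a factor lies above the diagonal unless
    k = i.                                                                    *)
Lemma trig_diag_grouplike r (c : 'M[H]_r) i :
  mult_mx c -> is_trig_mx c -> grouplike (c i i).
Proof.
move=> mc /is_trig_mxP tc.
rewrite /grouplike (mult_mx_comul _ _ mc) (mult_mx_counit _ _ mc) eqxx.
rewrite eqxx andbT (bigD1 i) //= big1 ?addr0 // => k ki.
move: ki; rewrite neq_ltn => /orP[ki|ik].
  by rewrite [c k i]tc // -[0]/(0 : H) -(scale0r 0) ptensZr scale0r.
rewrite [c i k]tc //; apply/matrixP => p q.
by rewrite !mxE linear0 mul0r.
Qed.

(** Induction on the distance i - j to the diagonal: in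
    sum_k c_ik S(c_kj) = 0 only k = i and k = j bring in c_ij.                *)
Lemma genfix_mult_mx r (c : 'M[H]_r) : mult_mx c -> is_trig_mx c ->
  forall i j, genfix s (c i j).
Proof.
move=> mc tri; have /is_trig_mxP tc := tri.
have cG i : grouplike (c i i) by apply: trig_diag_grouplike.
move=> i j; have [m] := ubnP (i - j)%N; elim: m i j => // m IH i j ijm.
have [ij|ji|ij] := ltngtP i j; first by rewrite tc //; apply: genfix0.
  2: by rewrite (val_inj ij); apply: genfix_grouplike.
apply: (genfix_skew_primitive (cG i) (cG j)).
have := mult_mx_mulSr i j mc; rewrite (negPf (_ : i != j)) ?neq_ltn ?ji ?orbT //.
rewrite (bigD1 i) //= (bigD1 j) /= ?neq_ltn ?ji // addrA => /eqP.
rewrite addr_eq0 => /eqP ->; apply/genfixN/genfix_sum => k /andP[ki kj].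
have [ik|ki'] := ltnP i k; first by rewrite tc // mul0r; apply: genfix0.
have [kj'|jk] := ltnP k j.
  by rewrite [c k j]tc // linear0 mulr0; apply: genfix0.
have {}ki : (k < i)%N by rewrite ltn_neqAle ki.
have {}kj : (j < k)%N by rewrite ltn_neqAle eq_sym kj.
apply: genfixM; last apply: genfix_antipode; apply: IH.
  by rewrite -ltnS; apply: leq_trans ijm; rewrite ltnS ltn_sub2l.
by rewrite -ltnS; apply: leq_trans ijm; rewrite ltnS ltn_sub2r.
Qed.

End SquareOfAntipode.

(** * The quasi-exponent *)

Section QuasiExponent.
Import GRing.Theory.
Local Open Scope ring_scope.
Local Open Scope hopf_scope.
Variables (F : fieldType) (H : hopfType F) (D : drinfeld_double H).
Local Notation sqinvH := (sqinv H).
Local Notation tcv := (@tconv F H).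
Local Notation tdiff := (@tconv_diff F H).

Section Upper.
Variable n : nat.
Hypothesis exp_n : forall g : H, grouplike g -> g ^+ n = 1.
Variables (r : nat) (c : 'M[H]_r).
Hypotheses (mc : mult_mx c) (tc : is_trig_mx c).
Hypothesis span_c : forall W : {vspace H},
  (forall i j, c i j \in W) -> forall x, x \in W.
Local Notation s := (iter n (@sqantipode F H) : {lrmorphism H -> H}).

Lemma moved_nilpotent : exists M, forall x, iter M (moved s) x = 0.
Proof.
have [m mE] := fin_all_exists (fun ij : 'I_r * 'I_r =>
  genfix_mult_mx exp_n mc tc ij.1 ij.2).
pose M := (\sum_ij m ij)%N; exists M => x.
pose g := GRing.isLinear.Build F H H *:%R (iter M (moved s)) (iter_movedP s M).
pose fl : {linear H -> H} := HB.pack (iter M (moved s)) g.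
suff : x \in lker (linfun fl) by rewrite memv_ker lfunE => /eqP.
apply: span_c => i j; rewrite memv_ker lfunE /= /M (bigD1 (i, j)) //= addnC.
by rewrite iterD mE iter_moved0.
Qed.

Lemma iter_sqantipodeK m : cancel (iter m sqinvH) (iter m (@sqantipode F H)).
Proof. by elim: m => // m IH x; rewrite iterSr iterS (sqantipodeK D) IH. Qed.

Lemma iter_sqinvK m : cancel (iter m (@sqantipode F H)) (iter m sqinvH).
Proof. by elim: m => // m IH x; rewrite iterSr iterS (sqinvK D) IH. Qed.

Lemma iter_sqinvB m x y : iter m sqinvH (x - y) = iter m sqinvH x - iter m sqinvH y.
Proof. by elim: m => //= m ->; rewrite linearB. Qed.

(** 1 - S^-2n is S^2n - 1 composed with the commuting operator S^-2n.         *)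
Lemma sqinv_unipotent :
  exists M, forall x, iter M (fun y => y - iter n sqinvH y) x = 0.
Proof.
have [M M0] := moved_nilpotent; exists M => x.
suff -> : iter M (fun y => y - iter n sqinvH y) x =
    iter M (moved s) (iter M (iter n sqinvH) x) by [].
have dE y : y - iter n sqinvH y = moved s (iter n sqinvH y).
  by rewrite /moved /= iter_sqantipodeK.
elim: M {M0} x => // M IH x; rewrite iterSr IH [in RHS]iterSr dE.
congr (iter M (moved s) _); rewrite [in RHS]iterSr; elim: M {IH} => // M IH.
by rewrite !iterS IH /moved iter_sqinvB /= iter_sqinvK iter_sqantipodeK.
Qed.

(** The filtration of End(H) on whose graded pieces [tconv] acts as
    c_ii S^-2.                                                                *)
Definition vanish_below i (f : 'End(H)) :=
  forall k j : 'I_r, (k < i)%N -> f (c k j) = 0.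

Lemma tconv_vanish i f : vanish_below i f -> vanish_below i (tconv f).
Proof.
move=> fi k j ki; rewrite (tconv_mult_mx _ _ _ mc) big1 // => l _.
have [lk|kl] := leqP l k; first by rewrite fi ?(leq_ltn_trans lk) // linear0 mulr0.
by rewrite (is_trig_mxP tc) // mul0r.
Qed.

Lemma tconv_diag (i j : 'I_r) f : vanish_below i f ->
  tconv f (c i j) = c i i * sqinvH (f (c i j)).
Proof.
move=> fi; rewrite (tconv_mult_mx _ _ _ mc) (bigD1 i) //= big1 ?addr0 // => l.
rewrite neq_ltn => /orP[li|il]; first by rewrite fi // linear0 mulr0.
by rewrite (is_trig_mxP tc) // mul0r.
Qed.

Lemma sqinvM x y : sqinvH (x * y) = sqinvH x * sqinvH y.
Proof.
apply: (can_inj (sqinvK D)); rewrite (sqantipodeK D) rmorphM /=.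
by rewrite !(sqantipodeK D).
Qed.

Lemma sqinv_grouplike g : grouplike g -> sqinvH g = g.
Proof. by move=> Gg; rewrite -{1}(sqantipode_grouplike Gg) (sqinvK D). Qed.

Lemma iter_tconv_vanish i f m : vanish_below i f -> vanish_below i (iter m tcv f).
Proof. by move=> fi; elim: m => [|m IH] //; rewrite iterS; apply: tconv_vanish. Qed.

Lemma iter_tconv_diag (i j : 'I_r) f m : vanish_below i f ->
  iter m tcv f (c i j) = c i i ^+ m * iter m sqinvH (f (c i j)).
Proof.
move=> fi; have Gi := trig_diag_grouplike i mc tc; elim: m => [|m IH].
  by rewrite mul1r.
rewrite !iterS tconv_diag; last exact: iter_tconv_vanish.
by rewrite IH sqinvM (sqinv_grouplike (grouplikeX m Gi)) mulrA exprS.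
Qed.

(** On row i, modulo the rows above, 1 - tconv^n is composition with 1 - S^-2n,
    and M steps kill that; so r M steps kill the r rows, which span H.        *)
Lemma tconv_diff_nilpotent f : exists2 N, (0 < N)%N & iter N (tdiff n) f = 0.
Proof.
have [M M0] := sqinv_unipotent.
have dvanish i g : vanish_below i g -> vanish_below i (tdiff n g).
  move=> gi k j ki; rewrite /tconv_diff add_lfunE opp_lfunE gi //.
  by rewrite (iter_tconv_vanish n gi) // subr0.
have step i g : vanish_below i g -> vanish_below i.+1 (iter M (tdiff n) g).
  move=> gi.
  have giM m : vanish_below i (iter m (tdiff n) g).
    by elim: m => //= m; apply: dvanish.
  move=> k j; rewrite ltnS leq_eqVlt => /orP[/eqP ki|]; last exact: giM.
  rewrite -ki in giM; rewrite -[RHS](M0 (g (c k j))).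
  elim: M {M0} => // m IH; rewrite !iterS -IH {1}/tconv_diff add_lfunE opp_lfunE.
  rewrite iter_tconv_diag; last exact: giM.
  by rewrite exp_n ?mul1r //; apply: trig_diag_grouplike.
(* One more step keeps the exponent positive when r M = 0. *)
exists (r * M).+1 => //; rewrite iterS.
have v0 : iter (r * M) (tdiff n) f = 0.
  have vr i : vanish_below i (iter (i * M) (tdiff n) f).
    by elim: i => // i IH; rewrite mulSn iterD; apply: step.
  apply/lfunP => x; rewrite zero_lfunE.
  suff : x \in lker (iter (r * M) (tdiff n) f) by rewrite memv_ker => /eqP.
  by apply: span_c => i j; rewrite memv_ker vr.
have t0 : tconv (0 : 'End(H)) = 0.
  apply/lfunP => x; rewrite lfunE /= zero_lfunE /conv /tlift big1 // => i _.
  by rewrite big1 // => j _; rewrite lfunE /= zero_lfunE linear0 mulr0 scaler0.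
rewrite v0 /tconv_diff sub0r; apply/eqP; rewrite oppr_eq0; apply/eqP.
by elim: n => //= m ->.
Qed.

End Upper.

(** If (1-x)^(k+2) = 0, then z = (1-x)^(k+1) satisfies z x = z. Multiplying
    1 + x + ... + x^(q-1) by z gives q z, and it gives 0 since
    z (1 + ... + x^(q-1)) = (1-x)^k (1 - x^q). So the nilpotency order drops. *)
Lemma unipotent_root1 (A : falgType F) (x : A) q N :
  [pchar F] =i pred0 -> (0 < q)%N -> x ^+ q = 1 -> (1 - x) ^+ N = 0 -> x = 1.
Proof.
move=> F0 q0 xq; elim: N => [/eqP|[_|N IH] zN]; first by rewrite oner_eq0.
  by apply/esym/eqP; rewrite -subr_eq0 -[_ - _]expr1 zN.
apply: IH; set z := _ ^+ N.+1 in zN *.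
have zx : z * x = z.
  have := zN; rewrite exprSr -/z mulrBr mulr1 => /eqP.
  by rewrite subr_eq0 => /eqP.
have zxi i : z * x ^+ i = z.
  by elim: i => [|i IHi]; rewrite ?mulr1 // exprSr mulrA IHi.
have : z *+ q = 0.
  transitivity (z * \sum_(i < q) x ^+ i).
    rewrite mulr_sumr; under eq_bigr do rewrite zxi.
    by rewrite sumr_const card_ord.
  rewrite /z exprSr -mulrA -opprB mulNr -subrX1 xq subrr oppr0 mulr0 //.
rewrite -scaler_nat => /eqP; rewrite scaler_eq0 => /orP[|/eqP //].
by have /pcharf0P -> := F0; rewrite eqn0Ngt q0.
Qed.

Lemma unipotent_exponent (g : H) m q : [pchar F] =i pred0 -> grouplike g ->
  (0 < q)%N -> g ^+ q = 1 -> unipotent (drinfeld_element D ^+ m) -> g ^+ m = 1.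
Proof.
move=> F0 Gg q0 gq /unipotent_drinfeldP[N _ N0].
have fixed y : sqantipode y = y -> sqinvH y = y by move=> {1}<-; rewrite (sqinvK D).
have it k (f : 'End(H)) : sqantipode (f g) = f g ->
    iter k tcv f g = g ^+ k * f g.
  move=> fg; elim: k => [|k IH]; first by rewrite mul1r.
  rewrite iterS tconv_grouplike // IH fixed ?mulrA ?exprS //.
  by rewrite rmorphM /= fg sqantipode_grouplike //; apply: grouplikeX.
have key N' : iter N' (tdiff m) (counit_end H) g = (1 - g ^+ m) ^+ N'.
  elim: N' => [|N' IH].
    by rewrite counit_endE grouplike_counit // scale1r.
  rewrite iterS /tconv_diff add_lfunE opp_lfunE -/(tdiff m) it IH.
    by rewrite exprS mulrBl mul1r.
  rewrite rmorphXn rmorphB rmorph1 /= sqantipode_grouplike //.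
  exact: grouplikeX.
apply: (unipotent_root1 (q := q) (N := N)) => //.
  by rewrite exprAC gq expr1n.
by rewrite -key N0 zero_lfunE.
Qed.

Lemma gval_expg (g : glike H) m : Defs.gval (g ^+ m)%g = Defs.gval g ^+ m.
Proof. by elim: m => // m IH; rewrite expgS exprS -IH. Qed.

Lemma qexp_pointed : [pchar F] =i pred0 -> pointed H ->
  qexp D = exponent [set: glike H].
Proof.
move=> F0 pH; pose n := exponent [set: glike H].
have n0 : (0 < n)%N by apply: exponent_gt0.
have exp_n (g : H) : grouplike g -> g ^+ n = 1.
  move=> Gg; rewrite -[g]/(Defs.gval (Glike Gg)) -gval_expg expg_exponent //.
  by rewrite inE.
have div m : unipotent (drinfeld_element D ^+ m) -> (n %| m)%N.
  move=> um; apply/exponentP => g _; apply: val_inj; rewrite /= gval_expg.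
  by rewrite (unipotent_exponent F0 (Defs.gvalP g) n0 (exp_n _ (Defs.gvalP g)) um).
have qn : is_qexp D n.
  split=> // [|m m0 /div]; last exact: dvdn_leq.
  have [r [c [mc tc span_c]]] := pointed_trig pH.
  by apply/unipotent_drinfeldP; apply: tconv_diff_nilpotent span_c _.
apply: classical_sets.xget_unique => // m [m0 um mmin]; apply/eqP.
by rewrite eqn_leq mmin ?(dvdn_leq m0 (div _ um)) //; case: qn.
Qed.

End QuasiExponent.

Theorem theorem4p6 (R : realType) (H : hopfType R[i]) (D : drinfeld_double H) :
  pointed H -> qexp D = exponent [set: glike H].
Proof. by apply: qexp_pointed; apply: Num.Theory.pchar_num. Qed.
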